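(* Let $D$ be a Dedekind domain, and let $\mathfrak m$ be a maximal ideal of $D$ with finite residue field. Then the map $$\widehat D_{\mathfrak m}\longrightarrow\operatorname{Hom}_D(\operatorname{Int}(D),D/\mathfrak m),\qquad \alpha\longmapsto\bigl(f\mapsto f(\alpha)\bmod \mathfrak m\widehat D_{\mathfrak m}\bigr)$$ is a $D$-algebra isomorphism. More generally, for any $D$-algebra $A$ that is an integral domain with $\mathfrak mA=0$ (equivalently, any domain extension $A$ of $D/\mathfrak m$), the map $\widehat D_{\mathfrak m}\to\operatorname{Hom}_D(\operatorname{Int}(D),D/\mathfrak m)$ sending $\alpha$ to $f\mapsto f(\alpha)\bmod\mathfrak m\widehat D_{\mathfrak m}$, the map $\operatorname{Hom}_D(\operatorname{Int}(D),D/\mathfrak m)\to\operatorname{Hom}_D(\operatorname{Int}(D),A)$ induced by $D/\mathfrak m\to A$, and the map $\widehat D_{\mathfrak m}\to\operatorname{Hom}_D(\operatorname{Int}(D),A)$ sending $\alpha$ to $f\mapsto$ (the image in $A$ of $f(\alpha)\bmod\mathfrak m\widehat D_{\mathfrak m}$) form a commutative triangle of $D$-algebra isomorphisms.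
   Context: All rings and algebras are commutative with identity. For an integral domain $D$ with quotient field $K$, $\operatorname{Int}(D)=\{f\in K[X]: f(D)\subseteq D\}$; $\operatorname{Hom}_D$ denotes the set of $D$-algebra homomorphisms. Dedekind domains are understood not to be fields, so $\mathfrak m\neq0$. $\widehat D_{\mathfrak m}$ is the $\mathfrak m$-adic completion of $D$ (equivalently of $D_{\mathfrak m}$); for $f\in\operatorname{Int}(D)$ and $\alpha\in\widehat D_{\mathfrak m}$ the value $f(\alpha)$, computed in the quotient field of $\widehat D_{\mathfrak m}$, lies in $\widehat D_{\mathfrak m}$, and $\widehat D_{\mathfrak m}/\mathfrak m\widehat D_{\mathfrak m}=D/\mathfrak m$. The $D$-algebra structure on $\operatorname{Hom}_D(\operatorname{Int}(D),A)$ is as follows. An $A$-$B$-biring is an $A$-algebra $S$ with $A$-algebra homomorphisms $\Delta^+,\Delta^\times:S\to S\otimes_AS$ and a map $\beta:B\to\operatorname{Hom}_A(S,A)$ making $S$ a $B$-algebra object in the opposite category of $A$-algebras. For each $A$-algebra $R$ it makes $\operatorname{Hom}_A(S,R)$ a $B$-algebra: the sum (resp. product) of $\varphi,\psi$ is the composite of $\Delta^+$ (resp. $\Delta^\times$) with $s\otimes t\mapsto\varphi(s)\psi(t)$, and $b\in B$ is sent to the composite $S\xrightarrow{\beta(b)}A\to R$. For a Dedekind domain $D$ (being a Krull domain), $\operatorname{Int}(D)$ has a unique $D$-$D$-biring structure such that the inclusion $D[X]\to\operatorname{Int}(D)$ is a biring homomorphism (compatible with all the structure), where on $D[X]$ one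 has $\Delta^+(X)=X\otimes1+1\otimes X$, $\Delta^\times(X)=X\otimes X$, $\beta(a)(f)=f(a)$. (Concretely, $\Delta^+(f)$ and $\Delta^\times(f)$ correspond to $f(X+Y)$ and $f(XY)$ under the identification of $\operatorname{Int}(D)\otimes_D\operatorname{Int}(D)$ with integer-valued polynomials in $X,Y$, and $\beta(a)(f)=f(a)$.) *)

(* Defs.v *)
From HB Require Import structures.
From mathcomp Require Import all_boot all_order all_algebra.
From mathcomp Require Import ring.
From mathcomp Require Import boolp classical_sets cardinality.

Set Implicit Arguments.
Unset Strict Implicit.
Unset Printing Implicit Defensive.

Import GRing.Theory.
Local Open Scope ring_scope.
Local Open Scope quotient_scope.

Section Tensor.
Variable D : comNzRingType.

Lemma lrmorph_ext (S R : comAlgType D) (f g : {lrmorphism S -> R}) :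
  f =1 g -> f = g.
Proof.
case: f g => f [[[a0 aD]] [[m1 mM]] [sc]] [g [[[a0' aD']] [[m1' mM']] [sc']]] /= fg.
have e : f = g by apply: funext.
by subst g; congr (GRing.LRMorphism.Pack (GRing.LRMorphism.Class _ _ _));
   congr (_ _); apply: Prop_irrelevance.
Qed.

(* The tensor product over D of two D-algebras, by its universal property for *)
(* bilinear maps; the ring structure is the one of tens1 and tensM.           *)
Record tensor (S T : comAlgType D) := Tensor {
  tens_alg :> comAlgType D;
  tens : S -> T -> tens_alg;
  tens_linl : forall t, linear (tens^~ t);
  tens_linr : forall s, linear (tens s);
  tens1 : tens 1 1 = 1;
  tensM : forall s s' t t', tens (s * s') (t * t') = tens s t * tens s' t';
  tens_ex : forall (M : lmodType D) (b : S -> T -> M),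
    (forall t, linear (b^~ t)) -> (forall s, linear (b s)) ->
    exists h : {linear tens_alg -> M}, forall s t, h (tens s t) = b s t;
  tens_uniq : forall (M : lmodType D) (h k : {linear tens_alg -> M}),
    (forall s t, h (tens s t) = k (tens s t)) -> h =1 k }.

Section Pairing.
Variables (S T : comAlgType D) (P : tensor S T).

Section Pair.
Variables (R : comAlgType D) (f : {lrmorphism S -> R}) (g : {lrmorphism T -> R}).

Lemma tens_pair_ex :
  exists h : {linear P -> R}, forall s t, h (tens P s t) = f s * g t.
Proof.
apply: (@tens_ex _ _ P R (fun s t => f s * g t)) => [t|s] a x y /=.
  by rewrite linearP mulrDl -scalerAl.
by rewrite linearP mulrDr -scalerAr.
Qed.

Definition tens_pair : P -> R := sval (cid tens_pair_ex).

HB.instance Definition _ := GRing.Linear.copy tens_pair (sval (cid tens_pair_ex)).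

Lemma tens_pairE s t : tens_pair (tens P s t) = f s * g t.
Proof. exact: (svalP (cid tens_pair_ex)). Qed.

Lemma tens_pair_monoid : monoid_morphism tens_pair.
Proof.
split; first by rewrite -tens1 tens_pairE !rmorph1 mulr1.
have linr (u : R) : linear (fun x : P => tens_pair x * u).
  by move=> a x y; rewrite linearP mulrDl -scalerAl.
have linl (y : P) : linear (fun x : P => tens_pair (x * y)).
  by move=> a x x'; rewrite mulrDl -scalerAl linearP.
pose H1 u : {linear P -> R} := HB.pack (fun x : P => tens_pair x * u)
  (GRing.isLinear.Build D P R _ _ (linr u)).
pose H2 y : {linear P -> R} := HB.pack (fun x : P => tens_pair (x * y))
  (GRing.isLinear.Build D P R _ _ (linl y)).
have step s t x : tens_pair (x * tens P s t) = tens_pair x * tens_pair (tens P s t).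
  have /= := @tens_uniq _ _ P R (H2 (tens P s t)) (H1 (tens_pair (tens P s t))).
  apply=> s' t'; rewrite /= -tensM !tens_pairE !rmorphM.
  by rewrite mulrACA.
move=> x y; have /= := @tens_uniq _ _ P R (H2 y) (H1 (tens_pair y)).
apply=> s t; rewrite /= mulrC step mulrC //.
Qed.

HB.instance Definition _ :=
  GRing.isMonoidMorphism.Build P R tens_pair tens_pair_monoid.

End Pair.
End Pairing.

Section TensorMap.
Variables (S T S' T' : comAlgType D) (P : tensor S T) (P' : tensor S' T').
Variables (f : {linear S -> S'}) (g : {linear T -> T'}).

Lemma tens_map_ex :
  exists h : {linear P -> P'}, forall s t, h (tens P s t) = tens P' (f s) (g t).
Proof.
apply: (@tens_ex _ _ P P' (fun s t => tens P' (f s) (g t))) => [t|s] a x y /=.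
  by rewrite linearP tens_linl.
by rewrite linearP tens_linr.
Qed.

Definition tens_map : {linear P -> P'} := sval (cid tens_map_ex).

Lemma tens_mapE s t : tens_map (tens P s t) = tens P' (f s) (g t).
Proof. exact: (svalP (cid tens_map_ex)). Qed.

End TensorMap.

Record cooperations (S : comAlgType D) := Cooperations {
  coop_tens : tensor S S;
  coadd : {lrmorphism S -> coop_tens};
  comul : {lrmorphism S -> coop_tens};
  coscal : D -> {lrmorphism S -> D^o} }.

(* The operations on Hom_D(S, R): compose with s (x) t |-> phi s * psi t.      *)
Section HomOperations.
Variables (S : comAlgType D) (C : cooperations S) (R : comAlgType D).
Implicit Types phi psi : {lrmorphism S -> R}.

Lemma hom_const_scalable b : scalable (fun s => (coscal C b s : D)%:A : R).
Proof. by move=> a s /=; rewrite linearZ /= scalerA. Qed.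

Definition hom_add phi psi : {lrmorphism S -> R} :=
  tens_pair phi psi \o coadd C.
Definition hom_mul phi psi : {lrmorphism S -> R} :=
  tens_pair phi psi \o comul C.
Definition hom_const (b : D) : {lrmorphism S -> R} :=
  HB.pack (in_alg R \o coscal C b)
    (GRing.isScalable.Build D S R _ _ (hom_const_scalable b)).

End HomOperations.

(* S is a D-algebra object in the opposite of the category of D-algebras,     *)
(* expressed on its functor of points R |-> Hom_D(S, R). The structure map    *)
(* b |-> hom_const b gives zero and one, and negation is multiplication by    *)
(* hom_const (-1), so that no antipode is part of the data.                   *)
Record is_biring (S : comAlgType D) (C : cooperations S) : Prop := IsBiring {
  hom_addA : forall R, associative (@hom_add S C R);
  hom_addC : forall R, commutative (@hom_add S C R);
  hom_add0 : forall R, left_id (hom_const C R 0) (@hom_add S C R);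
  hom_addN : forall R,
    left_inverse (hom_const C R 0) (hom_mul C (hom_const C R (-1))) (@hom_add S C R);
  hom_mulA : forall R, associative (@hom_mul S C R);
  hom_mulC : forall R, commutative (@hom_mul S C R);
  hom_mul1 : forall R, left_id (hom_const C R 1) (@hom_mul S C R);
  hom_mulDl : forall R, left_distributive (@hom_mul S C R) (@hom_add S C R);
  hom_constD : forall R, {morph hom_const C R : a b / a + b >-> hom_add C a b};
  hom_constM : forall R, {morph hom_const C R : a b / a * b >-> hom_mul C a b} }.

Record biring (S : comAlgType D) := Biring {
  biring_coop :> cooperations S;
  biringP : is_biring biring_coop }.

Definition biring_hom (S S' : comAlgType D) (B : biring S) (B' : biring S')
    (f : {lrmorphism S -> S'}) : Prop :=
  [/\ forall s, coadd B' (f s) = tens_map (coop_tens B) (coop_tens B') f f (coadd B s),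
      forall s, comul B' (f s) = tens_map (coop_tens B) (coop_tens B') f f (comul B s)
    & forall b s, coscal B' b (f s) = coscal B b s].

Definition bhom (S : comAlgType D) (B : biring S) (R : comAlgType D) : Type :=
  {lrmorphism S -> R}.

Section HomAlgebra.
Variables (S : comAlgType D) (B : biring S) (R : comAlgType D).
Implicit Types phi psi chi : bhom B R.

HB.instance Definition _ := gen_eqMixin (bhom B R).
HB.instance Definition _ := gen_choiceMixin (bhom B R).

Let add : bhom B R -> bhom B R -> bhom B R := @hom_add S B R.
Let mul : bhom B R -> bhom B R -> bhom B R := @hom_mul S B R.
Let const : D -> bhom B R := hom_const B R.

Let mulDl : left_distributive mul add. Proof. exact: hom_mulDl (biringP B) _. Qed.
Let mulC : commutative mul. Proof. exact: hom_mulC (biringP B) _. Qed.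
Let mul1 : left_id (const 1) mul. Proof. exact: hom_mul1 (biringP B) _. Qed.
Let addC : commutative add. Proof. exact: hom_addC (biringP B) _. Qed.
Let add0 : left_id (const 0) add. Proof. exact: hom_add0 (biringP B) _. Qed.
Let addN : left_inverse (const 0) (mul (const (-1))) add.
Proof. exact: hom_addN (biringP B) _. Qed.
Let addA : associative add. Proof. exact: hom_addA (biringP B) _. Qed.
Let mulA : associative mul. Proof. exact: hom_mulA (biringP B) _. Qed.
Let constD : {morph const : a b / a + b >-> add a b}.
Proof. exact: hom_constD (biringP B) _. Qed.
Let constM : {morph const : a b / a * b >-> mul a b}.
Proof. exact: hom_constM (biringP B) _. Qed.


HB.instance Definition _ := GRing.isZmodule.Build (bhom B R) addA addC add0 addN.
HB.instance Definition _ :=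
  GRing.Zmodule_isComPzRing.Build (bhom B R) mulA mulC mul1 mulDl.

Let scale (b : D) phi : bhom B R := const b * phi.

Let scaleA a b phi : scale a (scale b phi) = scale (a * b) phi.
Proof. by rewrite /scale [const (a * b)]constM -mulrA. Qed.

Let scale1 : left_id 1 scale. Proof. by move=> phi; apply: mul1. Qed.

Let scaleDr : right_distributive scale +%R.
Proof. by move=> b phi psi; apply: mulrDr. Qed.

Let scaleDl phi : {morph scale^~ phi : a b / a + b}.
Proof. by move=> a b; rewrite /scale [const (a + b)]constD mulrDl. Qed.

HB.instance Definition _ :=
  GRing.Zmodule_isLmodule.Build D (bhom B R) scaleA scale1 scaleDr scaleDl.

Lemma bhom_scalerAl (b : D) phi psi : b *: (phi * psi) = (b *: phi) * psi.
Proof. exact: mulrA. Qed.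

Lemma bhom_addE phi psi : phi + psi = hom_add B phi psi. Proof. by []. Qed.
Lemma bhom_mulE phi psi : phi * psi = hom_mul B phi psi. Proof. by []. Qed.
Lemma bhom_scale1E b : b *: (1 : bhom B R) = hom_const B R b.
Proof. by rewrite [LHS]mulr1. Qed.

End HomAlgebra.

(* The tensor square of D[X] is D[X, Y]. *)
Section PolyTensor.

Definition poly2 : Type := {poly {poly D}}.
HB.instance Definition _ := GRing.ComNzRing.on poly2.

Let scale (a : D) (p : poly2) : poly2 := a%:P *: (p : {poly {poly D}}).

Let scaleA a b p : scale a (scale b p) = scale (a * b) p.
Proof. by rewrite /scale scalerA polyCM. Qed.
Let scale1 : left_id 1 scale. Proof. by move=> p; apply: scale1r. Qed.
Let scaleDr : right_distributive scale +%R.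
Proof. by move=> b p q; apply: scalerDr. Qed.
Let scaleDl p : {morph scale^~ p : a b / a + b}.
Proof. by move=> a b; rewrite /scale polyCD scalerDl. Qed.

HB.instance Definition _ :=
  GRing.Zmodule_isLmodule.Build D poly2 scaleA scale1 scaleDr scaleDl.

Let scaleAl (a : D) (p q : poly2) : a *: (p * q) = (a *: p) * q.
Proof. exact: (@scalerAl {poly D} {poly {poly D}}). Qed.

HB.instance Definition _ := GRing.Lmodule_isLalgebra.Build D poly2 scaleAl.
HB.instance Definition _ := GRing.Lalgebra_isComAlgebra.Build D poly2.

Definition ptens (p q : {poly D}) : poly2 := p *: q^:P.

Lemma ptens_linl q : linear (ptens^~ q).
Proof.
move=> a p p'; rewrite /ptens scalerDl; congr (_ + _).
by rewrite -mul_polyC -scalerA.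
Qed.

Lemma ptens_linr p : linear (ptens p).
Proof.
move=> a q q'; rewrite /ptens -mul_polyC rmorphD rmorphM /= map_polyC /=.
by rewrite mul_polyC scalerDr !scalerA mulrC -scalerA.
Qed.

Lemma ptens1 : ptens 1 1 = 1. Proof. by rewrite /ptens rmorph1 scale1r. Qed.

Lemma ptensM p p' q q' : ptens (p * p') (q * q') = ptens p q * ptens p' q'.
Proof.
rewrite /ptens rmorphM /=.
by rewrite -(@scalerAl {poly D} {poly {poly D}}) -scalerAr scalerA.
Qed.

Lemma poly2E (p : poly2) :
  p = \sum_(i < size (p : {poly {poly D}}))
        \sum_(j < size (p : {poly {poly D}})`_i)
           (p : {poly {poly D}})`_i`_j *: ptens 'X^j 'X^i.
Proof.
rewrite -[LHS](@coefK {poly D}) poly_def; apply: eq_bigr => i _.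
have -> : \sum_(j < size (p : {poly {poly D}})`_i)
   (p : {poly {poly D}})`_i`_j *: ptens 'X^j 'X^i =
   ptens (\sum_(j < size (p : {poly {poly D}})`_i)
     (p : {poly {poly D}})`_i`_j *: 'X^j) 'X^i.
  rewrite /ptens scaler_suml; apply: eq_bigr => j _.
  by rewrite -[_ *: 'X^j]mul_polyC -[RHS]scalerA.
by rewrite -poly_def coefK /ptens map_polyXn.
Qed.

Section Universal.
Variables (M : lmodType D) (b : {poly D} -> {poly D} -> M).
Hypotheses (bl : forall q, linear (b^~ q)) (br : forall p, linear (b p)).

Let h (p : poly2) : M :=
  \sum_(i < size (p : {poly {poly D}})) b (p : {poly {poly D}})`_i 'X^i.

Let bl0 q : b 0 q = 0.
Proof.
by have := bl q (-1) 0 0; rewrite scaler0 addr0 scaleN1r addNr.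
Qed.

Let br0 p : b p 0 = 0.
Proof.
by have := br p (-1) 0 0; rewrite scaler0 addr0 scaleN1r addNr.
Qed.

Let hE n (p : {poly {poly D}}) : (size p <= n)%N -> h p = \sum_(i < n) b p`_i 'X^i.
Proof.
move=> le_n; rewrite /h -(subnKC le_n) big_split_ord /= [X in _ + X]big1 ?addr0 //.
by move=> i _; rewrite nth_default ?bl0 // leq_addr.
Qed.

Let hlin : linear h.
Proof.
move=> a p q; pose p' : {poly {poly D}} := p; pose q' : {poly {poly D}} := q.
pose k := maxn (size p') (size q').
have le1 : (size (a%:P *: p' + q')%R <= k)%N.
  rewrite (leq_trans (size_polyD _ _)) // geq_max leq_maxr andbT.
  by rewrite (leq_trans (size_scale_leq _ _)) // leq_maxl.
rewrite (hE le1) (@hE k p') ?leq_maxl // (@hE k q') ?leq_maxr //.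
rewrite scaler_sumr -big_split /=; apply: eq_bigr => i _.
by rewrite coefD coefZ mul_polyC bl.
Qed.

Lemma ptens_ex : exists h : {linear poly2 -> M}, forall p q, h (ptens p q) = b p q.
Proof.
pose H : {linear poly2 -> M} := HB.pack h (GRing.isLinear.Build D poly2 M _ _ hlin).
exists H => p q /=.
rewrite (@hE (size q)); last first.
  by rewrite /ptens (leq_trans (size_scale_leq _ _)) // size_map_polyC.
have -> : b p q = b p (\sum_(i < size q) q`_i *: 'X^i) by rewrite -poly_def coefK.
have bsum I r (F : I -> {poly D}) : b p (\sum_(i <- r) F i) = \sum_(i <- r) b p (F i).
  elim/big_rec2: _ => [|i x y _ <-]; first exact: br0.
  by have := br p 1 (F i) y; rewrite !scale1r.
rewrite bsum; apply: eq_bigr => i _.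
have -> : b p (q`_i *: 'X^i) = q`_i *: b p 'X^i.
  by have := br p q`_i 'X^i 0; rewrite !addr0 br0 addr0.
have := bl 'X^i q`_i p 0; rewrite bl0 !addr0 => <-; congr (b _ _).
by rewrite /ptens coefZ coef_map mulrC mul_polyC.
Qed.

End Universal.

Lemma ptens_uniq (M : lmodType D) (h k : {linear poly2 -> M}) :
  (forall p q, h (ptens p q) = k (ptens p q)) -> h =1 k.
Proof.
move=> hk p; rewrite [p]poly2E !linear_sum; apply: eq_bigr => i _.
by rewrite !linear_sum; apply: eq_bigr => j _; rewrite !linearZ /= hk.
Qed.

Definition poly_tensor : tensor {poly D} {poly D} :=
  Tensor ptens_linl ptens_linr ptens1 ptensM ptens_ex ptens_uniq.

(* horner_alg itself is only declared linear for the scaling in_alg R \; *%R. *)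
Definition poly_ev (R : comAlgType D) (r : R) (p : {poly D}) : R := horner_alg r p.

HB.instance Definition _ (R : comAlgType D) (r : R) :=
  GRing.RMorphism.copy (poly_ev r) (horner_alg r).

Lemma poly_ev_scalable (R : comAlgType D) (r : R) : scalable (poly_ev r).
Proof.
move=> a p; rewrite -mul_polyC rmorphM /=.
by rewrite {1}/poly_ev horner_algC -scalerAl mul1r.
Qed.

HB.instance Definition _ (R : comAlgType D) (r : R) :=
  GRing.isScalable.Build D {poly D} R _ (poly_ev r) (@poly_ev_scalable R r).

Lemma poly_evX (R : comAlgType D) (r : R) : poly_ev r 'X = r.
Proof. exact: horner_algX. Qed.

Lemma poly_hom_ext (R : comAlgType D) (f g : {lrmorphism {poly D} -> R}) :
  f 'X = g 'X -> f = g.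
Proof.
move=> fg; apply: lrmorph_ext; apply: poly_ind => [|p a IHp]; first by rewrite !rmorph0.
by rewrite !rmorphD !rmorphM /= IHp fg -alg_polyC !rmorph_alg.
Qed.

Definition poly_coop : cooperations {poly D} := Cooperations
  (poly_ev (tens poly_tensor 'X 1 + tens poly_tensor 1 'X))
  (poly_ev (tens poly_tensor 'X 'X))
  (fun a => poly_ev (a : D^o)).

Section PolyOps.
Variable R : comAlgType D.
Implicit Types f g : {lrmorphism {poly D} -> R}.

Lemma poly_hom_addX f g : hom_add poly_coop f g 'X = f 'X + g 'X.
Proof.
rewrite /= poly_evX linearD /= !tens_pairE.
by rewrite !rmorph1 mulr1 mul1r.
Qed.

Lemma poly_hom_mulX f g : hom_mul poly_coop f g 'X = f 'X * g 'X.
Proof. by rewrite /= poly_evX tens_pairE. Qed.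

Lemma poly_hom_constX b : hom_const poly_coop R b 'X = b%:A.
Proof. by rewrite /= poly_evX. Qed.

End PolyOps.

Definition poly_homE := (poly_hom_addX, poly_hom_mulX, poly_hom_constX).

Lemma poly_biringP : is_biring poly_coop.
Proof.
split=> R.
- by move=> f g h; apply: poly_hom_ext; rewrite !poly_homE addrA.
- by move=> f g; apply: poly_hom_ext; rewrite !poly_homE addrC.
- by move=> f; apply: poly_hom_ext; rewrite !poly_homE scale0r add0r.
- move=> f; apply: poly_hom_ext; rewrite !poly_homE.
  by rewrite scaleN1r mulN1r addNr scale0r.
- by move=> f g h; apply: poly_hom_ext; rewrite !poly_homE mulrA.
- by move=> f g; apply: poly_hom_ext; rewrite !poly_homE mulrC.
- by move=> f; apply: poly_hom_ext; rewrite !poly_homE scale1r mul1r.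
- by move=> f g h; apply: poly_hom_ext; rewrite !poly_homE mulrDl.
- by move=> a b; apply: poly_hom_ext; rewrite !poly_homE scalerDl.
- move=> a b; apply: poly_hom_ext; rewrite !poly_homE.
  by rewrite -scalerAl mul1r scalerA.
Qed.

Definition poly_biring : biring {poly D} := Biring poly_biringP.

End PolyTensor.
End Tensor.

(* Isomorphism of D-algebras. The library's algebras are non-zero rings by    *)
(* definition, whereas bhom B R may be zero: it is a ring and a module whose   *)
(* structures are compatible by bhom_scalerAl.                                *)
Notation dalg_iso f := [/\ bijective f, linear f & monoid_morphism f].


Local Notation "x %:F" := (@FracField.tofrac _ x) : ring_scope.

Section IntegerValued.
Variable D : idomainType.

Definition int_valued : {pred {poly {fraction D}}} :=
  fun f => `[< forall a : D, exists b : D, f.[a%:F] = b%:F >].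

Lemma int_valuedP (f : {poly {fraction D}}) :
  reflect (forall a : D, exists b : D, f.[a%:F] = b%:F) (f \in int_valued).
Proof. exact: asboolP. Qed.

Lemma int_valued_subring : subring_closed int_valued.
Proof.
split=> [|f g /int_valuedP fi /int_valuedP gi|f g /int_valuedP fi /int_valuedP gi];
  apply/int_valuedP => a.
- by exists 1; rewrite hornerC rmorph1.
- have [[b fb] [c gc]] := (fi a, gi a).
  by exists (b - c); rewrite hornerD hornerN fb gc rmorphB.
- have [[b fb] [c gc]] := (fi a, gi a).
  by exists (b * c); rewrite hornerM fb gc rmorphM.
Qed.

HB.instance Definition _ :=
  GRing.isSubringClosed.Build {poly {fraction D}} int_valued int_valued_subring.

Record Int := MkInt { int_poly :> {poly {fraction D}}; int_polyP : int_poly \in int_valued }.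

HB.instance Definition _ := [isSub for int_poly].
HB.instance Definition _ := [Choice of Int by <:].
HB.instance Definition _ := [SubChoice_isSubComNzRing of Int by <:].

Lemma int_scale_subproof (a : D) (f : Int) : a%:F *: int_poly f \in int_valued.
Proof.
apply/int_valuedP => x; have /int_valuedP/(_ x)[b fb] := int_polyP f.
by exists (a * b); rewrite hornerZ fb rmorphM.
Qed.

Let scale (a : D) (f : Int) : Int := MkInt (int_scale_subproof a f).

Let scaleA a b f : scale a (scale b f) = scale (a * b) f.
Proof. by apply: val_inj; rewrite /= scalerA rmorphM. Qed.
Let scale1 : left_id 1 scale.
Proof. by move=> f; apply: val_inj; rewrite /= rmorph1 scale1r. Qed.
Let scaleDr : right_distributive scale +%R.
Proof. by move=> a f g; apply: val_inj; rewrite /= scalerDr. Qed.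
Let scaleDl f : {morph scale^~ f : a b / a + b}.
Proof. by move=> a b; apply: val_inj; rewrite /= rmorphD scalerDl. Qed.

HB.instance Definition _ :=
  GRing.Zmodule_isLmodule.Build D Int scaleA scale1 scaleDr scaleDl.

Let scaleAl (a : D) (f g : Int) : a *: (f * g) = (a *: f) * g.
Proof. by apply: val_inj; rewrite /= scalerAl. Qed.

HB.instance Definition _ := GRing.Lmodule_isLalgebra.Build D Int scaleAl.
HB.instance Definition _ := GRing.Lalgebra_isComAlgebra.Build D Int.

Lemma int_of_poly_subproof (p : {poly D}) :
  map_poly (@FracField.tofrac D) p \in int_valued.
Proof. by apply/int_valuedP => a; exists p.[a]; rewrite horner_map. Qed.

Definition int_of_poly (p : {poly D}) : Int := MkInt (int_of_poly_subproof p).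

Lemma int_of_poly_additive : zmod_morphism int_of_poly.
Proof. by move=> p q; apply: val_inj; rewrite /= rmorphB. Qed.
Lemma int_of_poly_monoid : monoid_morphism int_of_poly.
Proof.
by split=> [|p q]; apply: val_inj; rewrite /= (rmorph1, rmorphM).
Qed.
Lemma int_of_poly_scalable : scalable int_of_poly.
Proof. by move=> a p; apply: val_inj; rewrite /= map_polyZ. Qed.

HB.instance Definition _ :=
  GRing.isZmodMorphism.Build {poly D} Int int_of_poly int_of_poly_additive.
HB.instance Definition _ :=
  GRing.isMonoidMorphism.Build {poly D} Int int_of_poly int_of_poly_monoid.
HB.instance Definition _ :=
  GRing.isScalable.Build D {poly D} Int _ int_of_poly int_of_poly_scalable.

Definition int_val (f : Int) (a : D) : D :=
  sval (cid (int_valuedP _ (int_polyP f) a)).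

Lemma int_valE f a : (int_val f a)%:F = (int_poly f).[a%:F].
Proof. by rewrite /int_val; case: cid. Qed.

End IntegerValued.

Section ResidueRing.
Variables (D : comNzRingType) (I : idealr D).
Local Notation quo := {ideal_quot I}.

Let scale (a : D) (x : quo) : quo := \pi_quo a * x.

Let scaleA a b x : scale a (scale b x) = scale (a * b) x.
Proof. by rewrite /scale rmorphM mulrA. Qed.
Let scale1 : left_id 1 scale. Proof. by move=> x; rewrite /scale rmorph1 mul1r. Qed.
Let scaleDr : right_distributive scale +%R. Proof. by move=> a x y; apply: mulrDr. Qed.
Let scaleDl x : {morph scale^~ x : a b / a + b}.
Proof. by move=> a b; rewrite /scale rmorphD mulrDl. Qed.

HB.instance Definition _ :=
  GRing.Zmodule_isLmodule.Build D (Quotient.quot I) scaleA scale1 scaleDr scaleDl.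

Let scaleAl (a : D) (x y : quo) : a *: (x * y) = (a *: x) * y.
Proof. exact: mulrA. Qed.

HB.instance Definition _ := GRing.Lmodule_isLalgebra.Build D (Quotient.quot I) scaleAl.
HB.instance Definition _ := GRing.Lalgebra_isComAlgebra.Build D (Quotient.quot I).

Lemma quo_eq (a b : D) : (\pi_quo a = \pi_quo b) <-> (a - b \in I).
Proof. by rewrite Quotient.idealrBE; split=> /eqP. Qed.

Lemma quo_scale1 (a : D) : a%:A = \pi_quo a.
Proof. exact: mulr1. Qed.

Section Lift.
Variables (A : comAlgType D) (IA0 : forall (a : D) (x : A), a \in I -> a *: x = 0).

(* The hypothesis is an argument so that the instances below can depend on it. *)
Definition residue_lift of (forall (a : D) (x : A), a \in I -> a *: x = 0) :=
  fun x : quo => (repr x)%:A : A.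
Local Notation lift := (residue_lift IA0).

Lemma residue_lift_pi a : lift (\pi_quo a) = a%:A.
Proof.
apply/eqP; rewrite -subr_eq0 -scalerBl; apply/eqP/IA0.
by apply/quo_eq; rewrite reprK.
Qed.

Lemma residue_lift_additive : zmod_morphism lift.
Proof.
move=> x y; rewrite -[x]reprK -[y]reprK -rmorphB !residue_lift_pi.
by rewrite scalerBl.
Qed.
Lemma residue_lift_monoid : monoid_morphism lift.
Proof.
split=> [|x y]; first by rewrite -(rmorph1 (\pi_quo)) residue_lift_pi scale1r.
rewrite -[x]reprK -[y]reprK -rmorphM !residue_lift_pi.
by rewrite -scalerAl mul1r scalerA.
Qed.
Lemma residue_lift_scalable : scalable lift.
Proof.
move=> a x; rewrite -[x]reprK -[_ *: _](rmorphM (\pi_quo)) !residue_lift_pi.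
by rewrite scalerA.
Qed.

HB.instance Definition _ :=
  GRing.isZmodMorphism.Build quo A lift residue_lift_additive.
HB.instance Definition _ :=
  GRing.isMonoidMorphism.Build quo A lift residue_lift_monoid.
HB.instance Definition _ :=
  GRing.isScalable.Build D quo A _ lift residue_lift_scalable.

End Lift.
End ResidueRing.

Section IdealPowers.
Variable D : comNzRingType.

Definition ideal_mul (I J : idealr D) : {pred D} := fun x =>
  `[< exists2 s : seq (D * D), all [pred p | (p.1 \in I) && (p.2 \in J)] s
                             & x = \sum_(p <- s) p.1 * p.2 >].

Lemma ideal_mulP (I J : idealr D) x :
  reflect (exists2 s : seq (D * D), all [pred p | (p.1 \in I) && (p.2 \in J)] s
                                  & x = \sum_(p <- s) p.1 * p.2)
          (x \in ideal_mul I J).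
Proof. exact: asboolP. Qed.

Lemma ideal_mul_subr (I J : idealr D) : {subset ideal_mul I J <= J}.
Proof.
move=> _ /ideal_mulP[s /allP sP ->]; rewrite big_seq rpred_sum // => p /sP /=.
by case/andP=> _; apply: idealMr.
Qed.

Lemma ideal_mul_closed (I J : idealr D) : idealr_closed (ideal_mul I J).
Proof.
split.
- by apply/ideal_mulP; exists [::]; rewrite ?big_nil.
- by apply/negP => /ideal_mul_subr; rewrite idealr1.
move=> a x y /ideal_mulP[s sP ->] /ideal_mulP[s' s'P ->].
apply/ideal_mulP; exists ([seq (a * p.1, p.2) | p <- s] ++ s').
  rewrite all_cat s'P andbT all_map; apply: sub_all sP => p /= /andP[p1 p2].
  by rewrite p2 idealMr.
rewrite big_cat big_map mulr_sumr /=; congr (_ + _).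
by apply: eq_bigr => p _; rewrite mulrA.
Qed.

HB.instance Definition _ (I J : idealr D) :=
  isIdealr.Build D (ideal_mul I J) (ideal_mul_closed I J).

(* ideal_pow I n is I^(n+1): idealr D only contains proper ideals.            *)
Fixpoint ideal_pow (I : idealr D) (n : nat) : idealr D :=
  if n is n'.+1 then ideal_mul I (ideal_pow I n') else I.

Lemma ideal_powS_sub I n : {subset ideal_pow I n.+1 <= ideal_pow I n}.
Proof. exact: ideal_mul_subr. Qed.

End IdealPowers.

Section Completion.
Variables (D : comNzRingType) (m : idealr D).
Local Notation quo n := {ideal_quot (ideal_pow m n)}.

(* The m-adic completion of D as the inverse limit of the D / m^(n+1): every  *)
(* representative of the component at n.+1 represents the component at n.     *)
Record completion := Completion {
  compon :> forall n, quo n;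
  componP : forall n a, compon n.+1 = \pi_(quo n.+1) a -> compon n = \pi_(quo n) a }.

HB.instance Definition _ := gen_eqMixin completion.
HB.instance Definition _ := gen_choiceMixin completion.

Lemma completionP (x y : completion) : (forall n, x n = y n) -> x = y.
Proof.
case: x y => [x xP] [y yP] /= xy; have e : x = y by apply: functional_extensionality_dep.
by subst y; congr Completion; apply: Prop_irrelevance.
Qed.

Lemma compon_rep (x : completion) n k a :
  x (n + k)%N = \pi_(quo (n + k)) a -> x n = \pi_(quo n) a.
Proof.
elim: k => [|k IHk]; first by rewrite addn0.
by rewrite addnS => /componP/IHk.
Qed.

Lemma compon_sub n a b : \pi_(quo n.+1) a = \pi_(quo n.+1) b -> \pi_(quo n) a = \pi_(quo n) b.
Proof. by move=> /quo_eq/ideal_powS_sub/quo_eq. Qed.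

Lemma add_compat (x y : completion) n a :
  x n.+1 + y n.+1 = \pi_(quo n.+1) a -> x n + y n = \pi_(quo n) a.
Proof.
have [r xr] : exists r, x n.+1 = \pi_(quo n.+1) r by exists (repr (x n.+1)); rewrite reprK.
have [s ys] : exists s, y n.+1 = \pi_(quo n.+1) s by exists (repr (y n.+1)); rewrite reprK.
by rewrite xr ys (componP xr) (componP ys) -!rmorphD => /compon_sub.
Qed.

Lemma mul_compat (x y : completion) n a :
  x n.+1 * y n.+1 = \pi_(quo n.+1) a -> x n * y n = \pi_(quo n) a.
Proof.
have [r xr] : exists r, x n.+1 = \pi_(quo n.+1) r by exists (repr (x n.+1)); rewrite reprK.
have [s ys] : exists s, y n.+1 = \pi_(quo n.+1) s by exists (repr (y n.+1)); rewrite reprK.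
by rewrite xr ys (componP xr) (componP ys) -!rmorphM => /compon_sub.
Qed.

Lemma opp_compat (x : completion) n a :
  - x n.+1 = \pi_(quo n.+1) a -> - x n = \pi_(quo n) a.
Proof.
have [r xr] : exists r, x n.+1 = \pi_(quo n.+1) r by exists (repr (x n.+1)); rewrite reprK.
by rewrite xr (componP xr) -!rmorphN => /compon_sub.
Qed.

Definition to_completion (a : D) : completion :=
  Completion (compon := fun n => \pi_(quo n) a) (fun n => @compon_sub n a).

Let add (x y : completion) : completion :=
  Completion (compon := fun n => x n + y n) (@add_compat x y).
Let mul (x y : completion) : completion :=
  Completion (compon := fun n => x n * y n) (@mul_compat x y).
Let opp (x : completion) : completion :=
  Completion (compon := fun n => - x n) (@opp_compat x).

Let addA : associative add.
Proof. by move=> x y z; apply: completionP => n; apply: addrA. Qed.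
Let addC : commutative add.
Proof. by move=> x y; apply: completionP => n; apply: addrC. Qed.
Let add0 : left_id (to_completion 0) add.
Proof. by move=> x; apply: completionP => n; rewrite /= rmorph0 add0r. Qed.
Let addN : left_inverse (to_completion 0) opp add.
Proof. by move=> x; apply: completionP => n; rewrite /= rmorph0 addNr. Qed.

HB.instance Definition _ := GRing.isZmodule.Build completion addA addC add0 addN.

Let mulA : associative mul.
Proof. by move=> x y z; apply: completionP => n; apply: mulrA. Qed.
Let mulC : commutative mul.
Proof. by move=> x y; apply: completionP => n; apply: mulrC. Qed.
Let mul1 : left_id (to_completion 1) mul.
Proof. by move=> x; apply: completionP => n; rewrite /= rmorph1 mul1r. Qed.
Let mulDl : left_distributive mul add.
Proof. by move=> x y z; apply: completionP => n; apply: mulrDl. Qed.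
Let one_neq0 : to_completion 1 != 0.
Proof.
apply/eqP => /(congr1 (fun x : completion => x 0%N)) /= /eqP.
by rewrite rmorph1 rmorph0 oner_eq0.
Qed.

HB.instance Definition _ :=
  GRing.Zmodule_isComNzRing.Build completion mulA mulC mul1 mulDl one_neq0.

Lemma to_completion_additive : zmod_morphism to_completion.
Proof. by move=> a b; apply: completionP => n; rewrite /= rmorphB. Qed.
Lemma to_completion_monoid : monoid_morphism to_completion.
Proof. by split=> // a b; apply: completionP => n; rewrite /= rmorphM. Qed.

HB.instance Definition _ :=
  GRing.isZmodMorphism.Build D completion to_completion to_completion_additive.
HB.instance Definition _ :=
  GRing.isMonoidMorphism.Build D completion to_completion to_completion_monoid.

Let scale (a : D) (x : completion) : completion := to_completion a * x.

Let scaleA a b x : scale a (scale b x) = scale (a * b) x.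
Proof. by rewrite /scale rmorphM mulrA. Qed.
Let scale1 : left_id 1 scale. Proof. by move=> x; rewrite /scale rmorph1 mul1r. Qed.
Let scaleDr : right_distributive scale +%R. Proof. by move=> a x y; apply: mulrDr. Qed.
Let scaleDl x : {morph scale^~ x : a b / a + b}.
Proof. by move=> a b; rewrite /scale rmorphD mulrDl. Qed.

HB.instance Definition _ :=
  GRing.Zmodule_isLmodule.Build D completion scaleA scale1 scaleDr scaleDl.

Let scaleAl (a : D) (x y : completion) : a *: (x * y) = (a *: x) * y.
Proof. exact: mulrA. Qed.

HB.instance Definition _ := GRing.Lmodule_isLalgebra.Build D completion scaleAl.
HB.instance Definition _ := GRing.Lalgebra_isComAlgebra.Build D completion.

Section Projection.
Variable n : nat.

Definition cproj (x : completion) : quo n := x n.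

Lemma cproj_additive : zmod_morphism cproj. Proof. by []. Qed.
Lemma cproj_monoid : monoid_morphism cproj. Proof. by split=> //; apply: rmorph1. Qed.
Lemma cproj_scalable : scalable cproj. Proof. by []. Qed.

HB.instance Definition _ :=
  GRing.isZmodMorphism.Build completion (quo n) cproj cproj_additive.
HB.instance Definition _ :=
  GRing.isMonoidMorphism.Build completion (quo n) cproj cproj_monoid.
HB.instance Definition _ :=
  GRing.isScalable.Build D completion (quo n) _ cproj cproj_scalable.

End Projection.

(* The kernel of cred is m times the completion (cred_eq0 below), so cred is  *)
(* reduction modulo it.                                                       *)
Definition cred (x : completion) : {ideal_quot m} := cproj 0 x.

HB.instance Definition _ := GRing.LRMorphism.copy cred (cproj 0).

End Completion.

Section Dedekind.
Variable D : idomainType.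

Definition finitely_generated (I : idealr D) : Prop :=
  exists n (e : 'I_n -> D), forall x, x \in I <-> exists c : 'I_n -> D, x = \sum_i c i * e i.

Definition maximal_ideal (I : idealr D) : Prop :=
  forall J : idealr D, {subset I <= J} -> {subset J <= I}.

(* idealr D only has proper ideals, but D itself is generated by 1. *)
Record dedekind : Prop := IsDedekind {
  dedekind_noetherian : forall I : idealr D, finitely_generated I;
  dedekind_int_closed : forall z : {fraction D},
    integralOver (@FracField.tofrac D) z -> exists a : D, z = a%:F;
  dedekind_dim1 : forall I : prime_idealr D,
    (exists2 a, a \in I & a != 0) -> maximal_ideal I;
  dedekind_not_field : exists2 a : D, a != 0 & a \isn't a GRing.unit }.

Section MaximalIdeal.
Variable (m : idealr D).
Hypothesis m_max : maximal_ideal m.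

Lemma maximal_comax s : s \notin m -> exists v w, w \in m /\ 1 = s * v + w.
Proof.
move=> sm; pose J : {pred D} := fun x => `[< exists v w, w \in m /\ x = s * v + w >].
have JP x : reflect (exists v w, w \in m /\ x = s * v + w) (x \in J) by apply: asboolP.
have [/JP//|J1] := boolP (1 \in J).
have Jid : idealr_closed J.
  split=> //; first by apply/JP; exists 0, 0; rewrite rpred0 mulr0 addr0.
  move=> a _ _ /JP[v [w [wm ->]]] /JP[v' [w' [wm' ->]]]; apply/JP.
  exists (a * v + v'), (a * w + w'); split; first by rewrite rpredD ?idealMr.
  by rewrite mulrDr mulrDr addrACA [s * (a * v)]mulrCA.
pose JI : idealr D := HB.pack J (isIdealr.Build D J Jid).
case/negP: sm; apply: (m_max (J := JI)) => [x xm|]; apply/JP.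
  by exists 0, x; rewrite mulr0 add0r.
by exists 1, 0; rewrite rpred0 mulr1 addr0.
Qed.

Lemma maximal_prime s s' : s \notin m -> s' \notin m -> s * s' \notin m.
Proof.
move=> sm; apply: contra => ssm.
have [v [w [wm e]]] := maximal_comax sm.
by rewrite -[s']mulr1 e mulrDr mulrA [s' * s]mulrC [_ * v]mulrC rpredD // idealMr.
Qed.

Lemma maximal_primeX s n : s \notin m -> s ^+ n \notin m.
Proof.
move=> sm; elim: n => [|n IHn]; first by rewrite expr0 idealr1.
by rewrite exprS maximal_prime.
Qed.

End MaximalIdeal.

Lemma noetherian_max (F : idealr D -> Prop) :
    (forall I : idealr D, finitely_generated I) -> (exists I, F I) ->
  exists2 I, F I & forall J, F J -> {subset I <= J} -> {subset J <= I}.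
Proof.
move=> noeth [I0 FI0]; apply: contrapT => nomax.
have step (I : {I | F I}) : exists J : {J | F J},
    {subset sval I <= sval J} /\ exists2 x, x \in sval J & x \notin sval I.
  case: I => I FI /=; apply: contrapT => no; apply: nomax; exists I => // J FJ IJ x xJ.
  apply: contrapT => /negP xI; apply: no; exists (exist _ J FJ); split=> //.
  by exists x.
have [nxt nxtP] := choice step.
pose ch n := sval (iter n nxt (exist _ I0 FI0)).
have ch1 n : {subset ch n <= ch n.+1} by have [] := nxtP (iter n nxt (exist _ I0 FI0)).
have chS n k : {subset ch n <= ch (n + k)%N}.
  by elim: k => [|k IHk] x; rewrite ?addn0 // addnS => /IHk/ch1.
have chle n k : (n <= k)%N -> {subset ch n <= ch k} by move=> /subnKC <-; apply: chS.
pose U : {pred D} := fun x => `[< exists n, x \in ch n >].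
have UP x : reflect (exists n, x \in ch n) (x \in U) by apply: asboolP.
have Uid : idealr_closed U.
  split; first by apply/UP; exists 0%N; rewrite rpred0.
    by apply/negP => /UP[n]; rewrite idealr1.
  move=> a x y /UP[n xn] /UP[k yk]; apply/UP; exists (maxn n k).
  by rewrite rpredD ?idealMr //; [apply: chle xn; apply: leq_maxl | apply: chle yk; apply: leq_maxr].
pose UI : idealr D := HB.pack U (isIdealr.Build D U Uid).
have [n [e eP]] := noeth UI.
have eU i : exists k, e i \in ch k.
  apply/UP/eP; exists (fun j => (j == i)%:R).
  rewrite (bigD1 i) //= eqxx mul1r big1 ?addr0 // => j /negPf ->.
  by rewrite mul0r.
have [k kP] := choice eU.
pose N := (\max_i k i)%N.
have UN x : x \in U -> x \in ch N.
  move/eP=> [c ->]; apply: rpred_sum => i _; apply: idealMr.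
  exact: (chle _ _ (leq_bigmax i)) (kP i).
have [_ [x xS /negP]] := nxtP (iter N nxt (exist _ I0 FI0)).
by apply; apply: UN; apply/UP; exists N.+1.
Qed.

Section Uniformizer.
Hypothesis D_ded : dedekind.
Variable m : idealr D.
Hypothesis m_max : maximal_ideal m.

Lemma maximal_neq0 : exists2 a, a \in m & a != 0.
Proof.
have [x x0 xu] := dedekind_not_field D_ded; apply: contrapT => m0.
have mE w : w \in m -> w = 0.
  by move=> wm; apply/eqP; apply: contrapT => /negP w0; apply: m0; exists w.
have xm : x \notin m by apply/negP => /mE/eqP; rewrite (negPf x0).
have [v [w [/mE-> e]]] := maximal_comax m_max xm.
by case/negP: xu; apply/unitrP; exists v; rewrite mulrC e addr0.
Qed.

(* lcolon b is the contraction to D of the ideal (a : b) of D_m. *)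
Section Colon.
Variable a : D.
Hypotheses (a_m : a \in m) (a_neq0 : a != 0).

Definition lcolon (b : D) : {pred D} := fun x =>
  `[< exists s c, s \notin m /\ s * x * b = a * c >].

Lemma lcolonP b x : reflect (exists s c, s \notin m /\ s * x * b = a * c) (x \in lcolon b).
Proof. exact: asboolP. Qed.

Lemma lcolon_closed b : 1 \notin lcolon b -> idealr_closed (lcolon b).
Proof.
split=> //.
  by apply/lcolonP; exists 1, 0; rewrite idealr1 !mulr0 mul0r.
move=> y x x' /lcolonP[s [c [sm e]]] /lcolonP[s' [c' [sm' e']]].
apply/lcolonP; exists (s * s'), (s' * y * c + s * c').
split; first exact: maximal_prime.
have -> : s * s' * (y * x + x') * b = s' * y * (s * x * b) + s * (s' * x' * b) by ring.
by rewrite e e'; ring.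
Qed.

(* m is an associated prime of D / (a): a maximal proper lcolon b is prime.   *)
Lemma colon_maximal : exists2 b, forall c, b != a * c &
  forall x, x \in m -> exists c, x * b = a * c.
Proof.
pose F (I : idealr D) := exists b, I =i lcolon b.
have mk b : 1 \notin lcolon b -> exists2 I : idealr D, F I & I =i lcolon b.
  move=> b1; pose I : idealr D := HB.pack (lcolon b) (isIdealr.Build D _ (lcolon_closed b1)).
  by exists I => //; exists b.
have lcolon1 : 1 \notin lcolon 1.
  apply/negP => /lcolonP[s [c [/negP sm e]]]; apply: sm.
  by rewrite -[s]mulr1 -[s * 1]mulr1 e mulrC idealMr.
have [I0 FI0 _] := mk _ lcolon1.
have [I [b Ib] Imax] := noetherian_max (dedekind_noetherian D_ded) (ex_intro _ _ FI0).
have b1 : 1 \notin lcolon b by rewrite -Ib idealr1.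
have Iprime : prime_idealr_closed I.
  move=> x y; rewrite !Ib => /lcolonP[s [c [sm e]]]; apply: contrapT.
  move=> /negP; rewrite negb_or => /andP[xb yb].
  have xb1 : 1 \notin lcolon (x * b).
    apply: contra xb => /lcolonP[s' [c' [sm' e']]]; apply/lcolonP.
    by exists s', c'; split=> //; rewrite -e'; ring.
  have [J FJ Jx] := mk _ xb1.
  case/negP: yb; rewrite -Ib; apply: (Imax J FJ) => [z|]; rewrite Jx; last first.
    by apply/lcolonP; exists s, c; split=> //; rewrite -e; ring.
  rewrite Ib => /lcolonP[s' [c' [sm' e']]]; apply/lcolonP.
  exists s', (c' * x); split=> //.
  have -> : s' * z * (x * b) = (s' * z * b) * x by ring.
  by rewrite e' mulrA.
pose P : prime_idealr D := HB.pack (I : D -> bool) (Idealr.class I)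
  (isPrimeIdealrClosed.Build D I Iprime).
have PI : P =i I by [].
have Pmax : maximal_ideal P.
  apply: (dedekind_dim1 D_ded); exists a => //; rewrite PI Ib; apply/lcolonP.
  by exists 1, b; rewrite idealr1 mul1r.
have Im x : x \in I -> x \in m.
  rewrite Ib => /lcolonP[s [c [sm e]]]; apply: contrapT => /negP xm.
  case/negP: b1; apply/lcolonP; exists (s * x), c.
  by rewrite mulr1 maximal_prime.
have mI x : x \in m -> x \in I by apply: (Pmax m).
have [n [e eP]] := dedekind_noetherian D_ded m.
have em i : e i \in m.
  apply/eP; exists (fun j => (j == i)%:R).
  rewrite (bigD1 i) //= eqxx mul1r big1 ?addr0 // => j /negPf ->.
  by rewrite mul0r.
have ex_s i : exists s, s \notin m /\ exists c, s * e i * b = a * c.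
  by have /mI := em i; rewrite Ib => /lcolonP[s [c [sm ec]]]; exists s; split=> //; exists c.
have [s sP] := choice ex_s.
pose t := \prod_i s i.
have tm : t \notin m.
  rewrite /t; elim/big_ind: _ => [|x y xm ym|i _]; first by rewrite idealr1.
    exact: maximal_prime.
  by have [] := sP i.
exists (t * b) => [c|x /eP[k ->]].
  apply: contra b1 => /eqP tb; apply/lcolonP; exists t, c.
  by rewrite mulr1.
have ex_c i : exists c, e i * (t * b) = a * c.
  have [_ [c ec]] := sP i; rewrite /t (bigD1 i) //=.
  exists (\prod_(j | j != i) s j * c).
  by rewrite [RHS]mulrCA -ec; ring.
have [c cP] := choice ex_c.
exists (\sum_i k i * c i); rewrite mulr_suml mulr_sumr; apply: eq_bigr => i _.
by rewrite -mulrA cP mulrCA.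
Qed.

End Colon.

(* Local generator of m: m D_m = t D_m. *)
Lemma uniformizer_ex : exists u t, [/\ u \notin m, t \in m, t != 0 &
  forall x, x \in m -> exists c, u * x = t * c].
Proof.
have [a am a0] := maximal_neq0.
have [b ba mb] := colon_maximal am a0.
have [n [e eP]] := dedekind_noetherian D_ded m.
have em i : e i \in m.
  apply/eP; exists (fun j => (j == i)%:R).
  rewrite (bigD1 i) //= eqxx mul1r big1 ?addr0 // => j /negPf ->.
  by rewrite mul0r.
have [t [u [tm um tu]]] : exists t u, [/\ t \in m, u \notin m & t * b = a * u].
  apply: contrapT => no.
  have ex_M i : exists c : 'I_n -> D, e i * b = a * \sum_j c j * e j.
    have [c ec] := mb _ (em i).
    have /eP[k kE] : c \in m by apply: contrapT => /negP cm; apply: no; exists (e i), c.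
    by exists k; rewrite -kE.
  have [M ME] := choice ex_M.
  pose A : 'M[D]_n := \matrix_(j, i) M i j.
  pose z : {fraction D} := b%:F / a%:F.
  have aF : a%:F != 0 :> {fraction D} by rewrite tofrac_eq0.
  have [d zd] : exists d : D, z = d%:F.
    apply: (dedekind_int_closed D_ded); exists (char_poly A); first exact: char_poly_monic.
    rewrite map_char_poly -eigenvalue_root_char; apply/eigenvalueP.
    exists (\row_i (e i)%:F).
      apply/rowP => i; rewrite !mxE.
      apply: (mulfI aF).
      have -> : a%:F * (z * (e i)%:F) = (e i * b)%:F.
        by rewrite /z mulrA mulrCA divff // mulr1 -rmorphM mulrC.
      rewrite ME rmorphM rmorph_sum; congr (_ * _); apply: eq_bigr => j _.
      by rewrite !mxE rmorphM mulrC.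
    apply/eqP => /rowP e0; have [k ak] := (eP a).1 am.
    case/eqP: a0; rewrite ak big1 // => i _; have := e0 i; rewrite !mxE => /eqP.
    by rewrite tofrac_eq0 => /eqP ->; rewrite mulr0.
  have /eqP : b%:F = (a * d)%:F by rewrite tofracM -zd /z mulrCA divff // mulr1.
  by rewrite tofrac_eq (negPf (ba d)).
exists u, t; split=> //.
  apply: contra um => /eqP t0; move: tu; rewrite t0 mul0r => /esym/eqP.
  by rewrite mulf_eq0 (negPf a0) /= => /eqP ->; rewrite rpred0.
move=> x /mb[c xc]; exists c; apply: (mulfI a0).
by rewrite mulrA -tu mulrAC -mulrA xc mulrCA.
Qed.

(* inpow k x: x lies in the k-th power of m, exponent 0 included. *)
Definition inpow (k : nat) (x : D) : bool :=
  if k is n.+1 then x \in ideal_pow m n else true.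

Lemma inpow0 k : inpow k 0. Proof. by case: k => //= n; apply: rpred0. Qed.

Lemma inpowD k x y : inpow k x -> inpow k y -> inpow k (x + y).
Proof. by case: k => //= n; apply: rpredD. Qed.

Lemma inpowB k x y : inpow k x -> inpow k y -> inpow k (x - y).
Proof. by case: k => //= n; apply: rpredB. Qed.

Lemma inpowMl k a x : inpow k x -> inpow k (a * x).
Proof. by case: k => //= n; apply: idealMr. Qed.

Lemma inpowS k x : inpow k.+1 x -> inpow k x.
Proof. by case: k => //= n; apply: ideal_powS_sub. Qed.

Lemma inpow_le j k x : (j <= k)%N -> inpow k x -> inpow j x.
Proof.
move=> /subnKC <-; elim: (k - j)%N => [|i IHi]; first by rewrite addn0.
by rewrite addnS => /inpowS.
Qed.

Lemma inpowM1 k a x : a \in m -> inpow k x -> inpow k.+1 (a * x).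
Proof.
case: k => [|n] am xn /=; first by rewrite mulrC idealMr.
by apply/ideal_mulP; exists [:: (a, x)]; rewrite ?big_seq1 //= am andbT.
Qed.

Lemma inpowSE k x : inpow k.+1 x -> exists2 s : seq (D * D),
  forall p, p \in s -> p.1 \in m /\ inpow k p.2 & x = \sum_(p <- s) p.1 * p.2.
Proof.
case: k => [|n] /=; last first.
  by move=> /ideal_mulP[s /allP sP ->]; exists s => // p /sP /andP[].
move=> xm; exists [:: (x, 1)]; last by rewrite big_seq1 mulr1.
by move=> p; rewrite inE => /eqP ->.
Qed.

Lemma inpowX t k : t \in m -> inpow k (t ^+ k).
Proof. by move=> tm; elim: k => // k IHk; rewrite exprS; apply: inpowM1. Qed.

Lemma inpow_cancel k s x : s \notin m -> inpow k (s * x) -> inpow k x.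
Proof.
move=> sm; elim: k => // k IHk sx; have [v [w [wm e]]] := maximal_comax m_max sm.
rewrite -[x]mul1r e mulrDl mulrAC; apply: inpowD; last by apply/inpowM1/IHk/inpowS.
by rewrite mulrC; apply: inpowMl.
Qed.

Section Valuation.
Variables u t : D.
Hypotheses (um : u \notin m) (tm : t \in m) (t0 : t != 0).
Hypothesis ut : forall x, x \in m -> exists c, u * x = t * c.

Lemma inpow_dvd k x : inpow k x -> exists c, u ^+ k * x = t ^+ k * c.
Proof.
elim: k x => [|k IHk] x; first by exists x.
move=> /inpowSE[s sP ->].
elim: s sP => [|p s IHs] sP; first by exists 0; rewrite big_nil !mulr0.
have [|c cE] := IHs; first by move=> q qs; apply: sP; rewrite inE qs orbT.
have [p1 /IHk[d dE]] : p.1 \in m /\ inpow k p.2 by apply: sP; rewrite inE eqxx.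
have [d' d'E] := ut p1; rewrite big_cons; exists (d' * d + c).
rewrite mulrDr cE mulrDr; congr (_ + _); rewrite !exprS.
have -> : u * u ^+ k * (p.1 * p.2) = (u * p.1) * (u ^+ k * p.2) by ring.
by rewrite dE d'E; ring.
Qed.

Lemma inpow_order k x : ~~ inpow k x -> exists i a,
  [/\ (i < k)%N, inpow i x, a \notin m & u ^+ i * x = t ^+ i * a].
Proof.
elim: k => // k IHk; have [xk xSk|/IHk[i [a [ik xi am e]]] _] := boolP (inpow k x); last first.
  by exists i, a; split=> //; apply: ltnW.
have [a e] := inpow_dvd xk; exists k, a; split=> //.
apply: contra xSk => am; apply: (inpow_cancel (maximal_primeX m_max k um)).
by rewrite e mulrC; apply: inpowM1 => //; apply: inpowX.
Qed.

Lemma inpow_prime p q x y : ~~ inpow p x -> ~~ inpow q y -> ~~ inpow (p + q).-1 (x * y).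
Proof.
move=> /inpow_order[i [a [ip _ am xE]]] /inpow_order[j [b [jq _ bm yE]]].
apply: contra (maximal_prime m_max um (maximal_prime m_max am bm)).
have le : ((i + j).+1 <= (p + q).-1)%N.
  by case: p ip => // p ip; rewrite addSn /= -addnS leq_add.
move=> /(inpow_le le)/inpow_dvd[c cE].
suff -> : u * (a * b) = t * c by rewrite mulrC idealMr.
apply: (mulfI (expf_neq0 (i + j) t0)).
rewrite [RHS](_ : _ = t ^+ (i + j).+1 * c); last by rewrite exprS; ring.
rewrite -cE exprS !exprD.
have -> : u * (u ^+ i * u ^+ j) * (x * y) = u * ((u ^+ i * x) * (u ^+ j * y)) by ring.
by rewrite xE yE; ring.
Qed.

Lemma inpow_krull x : (forall k, inpow k x) -> x = 0.
Proof.
move=> xP; apply/eqP; apply: contrapT => /negP x0.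
have [c cE] := choice (fun k => inpow_dvd (xP k)).
have u0 : u != 0 by apply: contra um => /eqP ->; rewrite rpred0.
have c0 k : c k != 0.
  apply/eqP => ck; have /eqP := cE k; rewrite ck mulr0 mulf_eq0 (negPf x0) orbF.
  by rewrite (negPf (expf_neq0 _ u0)).
have cS k : u * c k = t * c k.+1.
  apply: (mulfI (expf_neq0 k t0)).
  rewrite [RHS](_ : _ = t ^+ k.+1 * c k.+1); last by rewrite exprS; ring.
  by rewrite -cE exprS [LHS]mulrCA -cE; ring.
pose Jp k : {pred D} := fun y => `[< exists s d, s \notin m /\ s * y = c k * d >].
have JP k y : reflect (exists s d, s \notin m /\ s * y = c k * d) (y \in Jp k).
  exact: asboolP.
have Jid k : idealr_closed (Jp k).
  split.
  - by apply/JP; exists 1, 0; rewrite idealr1 !mulr0.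
  - apply/negP => /JP[s [d [sm e]]].
    have cm : c k \notin m.
      by apply: contra sm => ckm; rewrite -[s]mulr1 e mulrC idealMr.
    by case/negP: (maximal_prime m_max um cm); rewrite cS mulrC idealMr.
  move=> z y y' /JP[s [d [sm e]]] /JP[s' [d' [sm' e']]]; apply/JP.
  exists (s * s'), (s' * z * d + s * d'); split; first exact: maximal_prime.
  have -> : s * s' * (z * y + y') = s' * z * (s * y) + s * (s' * y') by ring.
  by rewrite e e'; ring.
pose J k : idealr D := HB.pack (Jp k) (isIdealr.Build D _ (Jid k)).
have [||_ [k ->] kmax] := @noetherian_max (fun I => exists k, I = J k).
- exact: dedekind_noetherian.
- by exists (J 0%N), 0%N.
have sub : {subset J k <= J k.+1}.
  move=> y /JP[s [d [sm e]]]; apply/JP; exists (u * s), (t * d).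
  split; first exact: maximal_prime.
  have -> : u * s * y = u * (s * y) by ring.
  by rewrite e mulrA cS; ring.
have : c k.+1 \in J k.
  apply: (kmax (J k.+1)) => //; first by exists k.+1.
  by apply/JP; exists 1, 1; rewrite idealr1 mulr1 mul1r.
move=> /JP[s [d [sm e]]]; case/negP: (maximal_prime m_max sm um).
suff -> : s * u = t * d by rewrite mulrC idealMr.
apply: (mulfI (c0 k)).
have -> : c k * (s * u) = s * (u * c k) by ring.
by rewrite cS mulrCA e; ring.
Qed.

End Valuation.

Lemma inpowM_prime p q x y : ~~ inpow p x -> inpow (p + q) (x * y) -> inpow q y.
Proof.
move=> xp; have [u [t [um tm t0 ut]]] := uniformizer_ex.
apply: contraTT => yq; apply: contra (inpow_prime um tm t0 ut xp yq).
by apply: inpow_le; apply: leq_pred.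
Qed.

Lemma inpow_sep x : x != 0 -> exists k, ~~ inpow k x.
Proof.
have [u [t [um tm t0 ut]]] := uniformizer_ex.
move=> x0; apply: contrapT => no; case/eqP: x0.
apply: (inpow_krull um tm t0 ut) => k; apply: contrapT => /negP xk.
by apply: no; exists k.
Qed.

End Uniformizer.
End Dedekind.

Section ClassicalUnits.
Variables (R : comNzRingType) (R_dom : GRing.integral_domain_axiom R).

Let unit : {pred R} := fun x => `[< exists y, y * x = 1 >].
Let inv (x : R) : R := if pselect (exists y, y * x = 1) is left h then sval (cid h) else x.

Let mulVx : {in unit, left_inverse 1 inv *%R}.
Proof.
move=> x /asboolP xu; rewrite /inv; case: pselect => // h.
exact: (svalP (cid h)).
Qed.
Let unitPl x y : y * x = 1 -> unit x.
Proof. by move=> yx; apply/asboolP; exists y. Qed.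
Let inv_out : {in [predC unit], inv =1 id}.
Proof. by move=> x /asboolP xu; rewrite /inv; case: pselect. Qed.

Let unitR : comUnitRingType := HB.pack_for comUnitRingType (GRing.ComNzRing.sort R)
  (GRing.ComNzRing_hasMulInverse.Build R mulVx unitPl inv_out).

(* A comNzRingType without zero divisors, as an idomainType. *)
Definition classical_idomain : idomainType :=
  HB.pack_for idomainType (GRing.ComNzRing.sort R) (GRing.ComUnitRing.class unitR)
    (GRing.ComUnitRing_isIntegral.Build unitR R_dom).

End ClassicalUnits.

Section FractionMap.
Variables (D E : idomainType) (f : {rmorphism D -> E}).

(* The map induced by an injective f on quotient fields.                      *)
Definition frac_map (f_inj : injective f) (z : {fraction D}) : {fraction E} :=
  (f (frac (repr z)).1)%:F / (f (frac (repr z)).2)%:F.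

Hypothesis f_inj : injective f.

Lemma frac_numden (F : idomainType) (z : {fraction F}) :
  z = (frac (repr z)).1%:F / (frac (repr z)).2%:F.
Proof.
have z2 : (frac (repr z)).2 != 0 by apply: denom_ratioP.
have zF : (frac (repr z)).2%:F != 0 :> {fraction F} by rewrite tofrac_eq0.
apply: (mulIf zF); rewrite divfK // -{1}[z]reprK; unlock FracField.tofrac.
rewrite -[LHS]FracField.pi_mul; apply/eqmodP; rewrite /= FracField.equivfE.
by rewrite /FracField.mulf !numden_Ratio ?mulr1 ?oner_neq0 // mulrC.
Qed.

Lemma frac_map_div n d : d != 0 -> frac_map f_inj (n%:F / d%:F) = (f n)%:F / (f d)%:F.
Proof.
have fF (a : D) : a != 0 -> (f a)%:F != 0 :> {fraction E}.
  by move=> a0; rewrite tofrac_eq0 -(rmorph0 f) (inj_eq f_inj).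
move=> d0; set z := _ / _; have := frac_numden z; rewrite /frac_map.
have : (frac (repr z)).2 != 0 by apply: denom_ratioP.
move: (frac (repr z)).1 (frac (repr z)).2 => a b b0.
have dF : d%:F != 0 :> {fraction D} by rewrite tofrac_eq0.
have bF : b%:F != 0 :> {fraction D} by rewrite tofrac_eq0.
move/eqP; rewrite eqr_div // -!tofracM tofrac_eq => /eqP e.
by apply/eqP; rewrite eqr_div ?fF // -!tofracM tofrac_eq -!rmorphM e.
Qed.

Lemma frac_map_additive : zmod_morphism (frac_map f_inj).
Proof.
move=> x y; rewrite (frac_numden x) (frac_numden y).
move: (frac _).1 (frac _).2 (denom_ratioP (repr x)) => a b b0.
move: (frac _).1 (frac _).2 (denom_ratioP (repr y)) => c d d0.
have fF (u : D) : u != 0 -> (f u)%:F != 0 :> {fraction E}.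
  by move=> u0; rewrite tofrac_eq0 -(rmorph0 f) (inj_eq f_inj).
have gF (u : D) : u != 0 -> u%:F != 0 :> {fraction D} by rewrite tofrac_eq0.
rewrite -mulNr addf_div ?gF // -tofracN -!tofracM -tofracD !frac_map_div ?mulf_neq0 //.
by rewrite -[X in _ = _ + X]mulNr addf_div ?fF // -tofracN -!tofracM -tofracD !rmorphM /= rmorphD !rmorphM rmorphN.
Qed.

Lemma frac_map_tofrac a : frac_map f_inj a%:F = (f a)%:F.
Proof.
have := frac_map_div a (oner_neq0 D).
by rewrite !rmorph1 !divr1.
Qed.

Lemma frac_map_monoid : monoid_morphism (frac_map f_inj).
Proof.
split=> [|x y]; first by rewrite -tofrac1 frac_map_tofrac !rmorph1.
rewrite (frac_numden x) (frac_numden y).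
move: (frac _).1 (frac _).2 (denom_ratioP (repr x)) => a b b0.
move: (frac _).1 (frac _).2 (denom_ratioP (repr y)) => c d d0.
rewrite mulf_div -!tofracM !frac_map_div ?mulf_neq0 //.
by rewrite mulf_div -!tofracM !rmorphM.
Qed.

HB.instance Definition _ := GRing.isZmodMorphism.Build {fraction D} {fraction E}
  (frac_map f_inj) frac_map_additive.
HB.instance Definition _ := GRing.isMonoidMorphism.Build {fraction D} {fraction E}
  (frac_map f_inj) frac_map_monoid.

End FractionMap.

Lemma frac_poly_denom (D : idomainType) (f : {poly {fraction D}}) :
  exists d (g : {poly D}), d != 0 /\ d%:F *: f = map_poly (@FracField.tofrac D) g.
Proof.
elim/poly_ind: f => [|f c [d [g [d0 e]]]].
  by exists 1, 0; rewrite oner_neq0 scaler0 rmorph0.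
have b0 : (frac (repr c)).2 != 0 by apply: denom_ratioP.
have := frac_numden c; move: (frac _).1 (frac _).2 b0 => a b b0 cE.
exists (b * d), (b *: g * 'X + (d * a)%:P); rewrite mulf_neq0 //; split=> //.
rewrite tofracM rmorphD rmorphM /= map_polyX map_polyC map_polyZ -e cE.
rewrite scalerA scalerDr scalerAl; congr (_ + _).
rewrite -mul_polyC -polyCM /= tofracM; congr _%:P.
rewrite [b%:F * _]mulrC -mulrA; congr (_ * _).
by rewrite mulrCA divff ?mulr1 ?tofrac_eq0.
Qed.

Section Evaluation.
Variables (D : idomainType) (D_ded : dedekind D) (m : idealr D).
Hypothesis m_max : maximal_ideal m.
Local Notation quo n := {ideal_quot (ideal_pow m n)}.
Local Notation Dm := (completion m).

Lemma inpow_pi n (a b : D) : \pi_(quo n) a = \pi_(quo n) b <-> inpow m n.+1 (a - b).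
Proof. exact: quo_eq. Qed.

Lemma compon_repr (x : Dm) n k : x n = \pi_(quo n) (repr (x (n + k)%N)).
Proof. by apply: (@compon_rep _ _ x n k); rewrite reprK. Qed.

Lemma completion_domain : GRing.integral_domain_axiom Dm.
Proof.
have nz (x : Dm) : x != 0 ->
    exists n, forall N a, (n <= N)%N -> x N = \pi_(quo N) a -> ~~ inpow m n.+1 a.
  move=> x0; have [n xn] : exists n, x n != 0.
    apply: contrapT => no; case/eqP: x0; apply: completionP => n.
    apply: etrans (esym (rmorph0 (\pi_(quo n)))).
    by apply/eqP; apply: contrapT => /negP xn; apply: no; exists n.
  exists n => N a /subnKC <- /compon_rep xa; apply: contra xn; rewrite xa => an.
  apply/eqP; transitivity (\pi_(quo n) 0); last exact: rmorph0.
  by apply/inpow_pi; rewrite subr0.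
move=> x y xy; apply: contrapT => /negP; rewrite negb_or => /andP[x0 y0].
have [[i iP] [j jP]] := (nz x x0, nz y y0); pose N := (i.+1 + j)%N.
have xi := iP N _ (leq_trans (leqnSn i) (leq_addr _ _)) (esym (reprK _)).
case/negP: (jP N _ (leq_addl _ _) (esym (reprK _))).
apply: (inpowM_prime D_ded m_max xi); rewrite addnS.
suff /inpow_pi : \pi_(quo N) (repr (x N) * repr (y N)) = \pi_(quo N) 0 by rewrite subr0.
rewrite rmorphM /= !reprK.
exact: (congr1 (fun z : Dm => z N) xy).
Qed.


Lemma to_completion_inj : injective (@to_completion D m).
Proof.
move=> a b ab; apply/eqP; rewrite -subr_eq0; apply: contrapT => /negP.
move=> /(inpow_sep D_ded m_max)[k /negP]; apply.
apply: (inpow_le (leqnSn k)); apply/inpow_pi.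
exact: (congr1 (fun x : Dm => x k) ab).
Qed.

Definition completion_idomain : idomainType := classical_idomain completion_domain.
Local Notation Dhat := completion_idomain.
Local Notation emb := (@to_completion D m : {rmorphism D -> Dhat}).

(* f(alpha), in the quotient field of the completion. *)
Definition frac_eval (f : {poly {fraction D}}) (alpha : Dm) : {fraction Dhat} :=
  (map_poly (@frac_map D Dhat emb to_completion_inj) f).[(alpha : Dhat)%:F].

Lemma frac_eval_in (f : Int D) (alpha : Dm) :
  exists beta : Dm, frac_eval f alpha = (beta : Dhat)%:F.
Proof.
have [d [g [d0 dfg]]] := frac_poly_denom (int_poly f).
have ivE a : d * int_val f a = g.[a].
  apply/eqP; rewrite -tofrac_eq tofracM int_valE -hornerZ dfg.
  by rewrite horner_map.
have [k dk] := inpow_sep D_ded m_max d0.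
have cont n a b : inpow m (k + n) (a - b) -> inpow m n (int_val f a - int_val f b).
  move=> ab; apply: (inpowM_prime D_ded m_max dk).
  rewrite mulrBr !ivE.
  have [q ->] : exists q, g.[a] - g.[b] = q * (a - b).
    have /factor_theorem[p pE] : root (g - g.[b]%:P) b by rewrite rootE !hornerE subrr.
    by exists p.[a]; have := congr1 (horner^~ a) pE; rewrite !hornerE.
  exact: inpowMl.
have near n N a : alpha N = \pi_(quo N) a -> (n + k <= N)%N ->
    \pi_(quo n) (int_val f (repr (alpha (n + k)%N))) = \pi_(quo n) (int_val f a).
  move=> Na le_nN; apply/inpow_pi/cont; rewrite addnC addSn.
  apply/inpow_pi; rewrite reprK; move: Na; rewrite -(subnKC le_nN).
  exact: compon_rep.
have compat n a : \pi_(quo n.+1) (int_val f (repr (alpha (n.+1 + k)%N))) = \pi_(quo n.+1) a ->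
    \pi_(quo n) (int_val f (repr (alpha (n + k)%N))) = \pi_(quo n) a.
  by move=> /compon_sub <-; apply: near (leq_addr 1 _); rewrite addn1 -addSn reprK.
pose beta : Dm := Completion (compon := fun n => \pi_(quo n) (int_val f (repr (alpha (n + k)%N)))) compat.
have dbeta : to_completion m d * beta = (map_poly (@to_completion D m) g).[alpha].
  apply: completionP => n.
  transitivity (\pi_(quo n) (d * int_val f (repr (alpha (n + k)%N)))); first by rewrite rmorphM.
  rewrite ivE -horner_map /= -compon_repr -[RHS]/(cproj n _) -horner_map -map_poly_comp.
  by congr _.[_].
exists beta.
have dF : (to_completion m d : Dhat)%:F != 0 :> {fraction Dhat}.
  by rewrite tofrac_eq0 -(rmorph0 (@to_completion D m)) (inj_eq to_completion_inj).
apply: (mulfI dF); rewrite -[RHS]tofracM [_ * _ in RHS]dbeta.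
rewrite -(@frac_map_tofrac D Dhat emb to_completion_inj) -hornerZ -map_polyZ dfg.
by rewrite -horner_map -!map_poly_comp; congr _.[_]; apply: eq_map_poly => a /=; rewrite frac_map_tofrac.
Qed.

Definition int_eval (alpha : Dm) (f : Int D) : Dm := sval (cid (frac_eval_in f alpha)).

Lemma int_evalE (alpha : Dm) (f : Int D) :
  (int_eval alpha f : Dhat)%:F = frac_eval f alpha.
Proof. by rewrite /int_eval; case: cid. Qed.

Let tofrac_inj (x y : Dhat) : x%:F = y%:F -> x = y.
Proof. by move/eqP; rewrite tofrac_eq => /eqP. Qed.

Lemma int_eval_additive alpha : zmod_morphism (int_eval alpha).
Proof.
move=> f g; apply: tofrac_inj; rewrite int_evalE.
rewrite (tofracB (int_eval alpha f : Dhat)) !int_evalE /frac_eval.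
by rewrite rmorphB hornerD hornerN.
Qed.

Lemma int_eval_monoid alpha : monoid_morphism (int_eval alpha).
Proof.
split=> [|f g]; apply: tofrac_inj; rewrite int_evalE /frac_eval.
  by rewrite rmorph1 hornerC (tofrac1 Dhat).
by rewrite (tofracM (int_eval alpha f : Dhat)) !int_evalE rmorphM hornerM.
Qed.

Lemma int_eval_scalable alpha : scalable (int_eval alpha).
Proof.
move=> a f; apply: tofrac_inj; rewrite int_evalE /frac_eval.
rewrite (tofracM (to_completion m a : Dhat)) int_evalE /= map_polyZ hornerZ /=.
by rewrite (@frac_map_tofrac D Dhat emb to_completion_inj).
Qed.

HB.instance Definition _ alpha :=
  GRing.isZmodMorphism.Build (Int D) Dm (int_eval alpha) (int_eval_additive alpha).
HB.instance Definition _ alpha :=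
  GRing.isMonoidMorphism.Build (Int D) Dm (int_eval alpha) (int_eval_monoid alpha).
HB.instance Definition _ alpha :=
  GRing.isScalable.Build D (Int D) Dm _ (int_eval alpha) (int_eval_scalable alpha).

Lemma cred_eq0 (x : Dm) : cred x = 0 <->
  exists2 s : seq (D * Dm), forall p, p \in s -> p.1 \in m
                          & x = \sum_(p <- s) p.1 *: p.2.
Proof.
split=> [x0|[s sm ->]]; last first.
  rewrite linear_sum big_seq big1 // => p /sm pm; rewrite linearZ /=.
  by rewrite -[RHS](mul0r (cred p.2)) -[LHS]/(_ * _); congr (_ * _);
     rewrite -(rmorph0 (\pi_{ideal_quot m})); apply/quo_eq; rewrite subr0.
have [u [t [um tm t0 ut]]] := uniformizer_ex D_ded m_max.
have [v [w [wm e]]] := maximal_comax m_max um.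
have xm n : repr (x n) \in m.
  have : \pi_{ideal_quot m} (repr (x n)) = \pi_{ideal_quot m} 0.
    rewrite rmorph0 -[RHS]x0; apply/esym.
    by apply: (@compon_rep _ _ x 0 n); rewrite reprK.
  by move/quo_eq; rewrite subr0.
have [c cE] := choice (fun n => ut _ (xm n)).
have t2 : ~~ inpow m 2 t.
  apply/negP => /(inpow_dvd ut)[d dE]; case/negP: (maximal_primeX m_max 2 um).
  suff -> : u ^+ 2 = d * t by rewrite idealMr.
  by apply: (mulIf t0); rewrite dE; ring.
have cS n : \pi_(quo n) (c n.+3) = \pi_(quo n) (c n.+2).
  apply/inpow_pi/(inpowM_prime D_ded m_max t2); rewrite mulrBr -!cE -mulrBr.
  apply/inpowMl/(inpow_pi n.+2); rewrite !reprK.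
  by apply/esym/(@compon_rep _ _ x n.+2 1); rewrite addn1 reprK.
have compat n a : \pi_(quo n.+1) (c n.+3) = \pi_(quo n.+1) a ->
    \pi_(quo n) (c n.+2) = \pi_(quo n) a.
  by move=> /compon_sub <-; rewrite cS.
pose gam : Dm := Completion (compon := fun n => \pi_(quo n) (c n.+2)) compat.
have uxE : u *: x = t *: gam.
  apply: completionP => n; apply: etrans (_ : \pi_(quo n) (u * repr (x n.+2)) = _).
    rewrite rmorphM; congr (_ * _); apply: (@compon_rep _ _ x n 2).
    by rewrite addn2 reprK.
  by rewrite cE rmorphM.
exists [:: (t, v *: gam); (w, x)].
  by move=> p; rewrite !inE => /orP[] /eqP ->.
rewrite big_cons big_seq1 /= scalerA mulrC -scalerA -uxE scalerA -scalerDl.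
by rewrite mulrC -e scale1r.
Qed.

Definition reduction_at (alpha : Dm) : {lrmorphism Int D -> {ideal_quot m}} :=
  @cred D m \o int_eval alpha.

End Evaluation.

Section Maps.
Variables (D : idomainType) (D_ded : dedekind D) (m : idealr D).
Variables (m_max : maximal_ideal m) (B : biring (Int D)).

Definition to_residue_hom : completion m -> bhom B {ideal_quot m} :=
  fun alpha => reduction_at D_ded m_max alpha.

Variables (A : comAlgType D) (mA0 : forall (a : D) (x : A), a \in m -> a *: x = 0).

Definition hom_extend (phi : bhom B {ideal_quot m}) : bhom B A :=
  (residue_lift mA0 : {lrmorphism {ideal_quot m} -> A}) \o
  (phi : {lrmorphism Int D -> {ideal_quot m}}).

Definition to_hom : completion m -> bhom B A :=
  fun alpha => (residue_lift mA0 : {lrmorphism {ideal_quot m} -> A}) \o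
    reduction_at D_ded m_max alpha.

End Maps.

(* Main.v *)
Require Import Defs.
From HB Require Import structures.
From mathcomp Require Import all_boot all_order all_algebra.
From mathcomp Require Import boolp classical_sets cardinality.
From mathcomp Require Import ring.

(* Int(D) is generated by X up to D-torsion, so evaluation at alpha is the     *)
(* only homomorphism from Int(D) to the completion sending X to alpha. As      *)
(* homomorphisms to a D-algebra are added and multiplied by adding and         *)
(* multiplying the images of X, this makes alpha |-> ev_alpha an algebra map,  *)
(* and reduction modulo m preserves the algebra structure by naturality.       *)
(* For bijectivity, choose u outside m and t in m with u m contained in t D.   *)
(* If g(D) is contained in m, then u g = t h with h integer-valued, so g is    *)
(* killed by every phi : Int(D) -> A with A a domain and m A = 0. Applied to   *)
(* products of the f - r, this shows that on finitely many f such a phi is     *)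
(* evaluation at one point x of D. Finally let F_0 = X and                     *)
(* t F_(k+1) = u prod_r (F_k - r), r running over the residues: by a Hensel    *)
(* argument the residues of F_0(x), ..., F_n(x) determine x modulo m^(n+1), so *)
(* the points x attached to F_0, ..., F_n converge in the completion.          *)

Set Implicit Arguments.
Unset Strict Implicit.
Unset Printing Implicit Defensive.

Import GRing.Theory.
Local Open Scope classical_set_scope.
Local Open Scope ring_scope.
Local Open Scope quotient_scope.

Local Notation "x %:F" := (@FracField.tofrac _ x) : ring_scope.

(** The homomorphism property holds already for evaluation with values in the completion, where
    [int_hom_ext] reduces it to the image of X; [bhom_comp_linear] and [bhom_comp_monoid] push it
    along [cred]. Bijectivity rests on three facts: the separating polynomials of [separating_seq],
    the continuity of reduced evaluation ([reduction_at_approx]) and the interpolation of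
    homomorphisms at points of D ([hom_approx]). The first two give [reduction_at_inj]; all three
    give [hom_point], which yields surjectivity for D/m and for A alike. *)

(** * Functoriality of the algebra Hom_D(S, R) in R *)

Section HomNaturality.
Variables (D : comNzRingType) (S : comAlgType D) (C : cooperations S).
Variables (R R' : comAlgType D) (h : {lrmorphism R -> R'}).
Implicit Types phi psi : {lrmorphism S -> R}.

Lemma tens_pair_comp phi psi (z : coop_tens C) :
  tens_pair (h \o phi : {lrmorphism S -> R'}) (h \o psi : {lrmorphism S -> R'}) z =
  h (tens_pair phi psi z).
Proof.
apply: (@tens_uniq _ _ _ (coop_tens C) R'
  (tens_pair (h \o phi : {lrmorphism S -> R'}) (h \o psi : {lrmorphism S -> R'}))
  (h \o tens_pair phi psi)) => s t.
by rewrite /= !tens_pairE /= rmorphM.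
Qed.

Lemma hom_add_comp phi psi :
  hom_add C (h \o phi : {lrmorphism S -> R'}) (h \o psi : {lrmorphism S -> R'}) =
  h \o hom_add C phi psi.
Proof. by apply: lrmorph_ext => s; apply: tens_pair_comp. Qed.

Lemma hom_mul_comp phi psi :
  hom_mul C (h \o phi : {lrmorphism S -> R'}) (h \o psi : {lrmorphism S -> R'}) =
  h \o hom_mul C phi psi.
Proof. by apply: lrmorph_ext => s; apply: tens_pair_comp. Qed.

Lemma hom_const_comp b : hom_const C R' b = h \o hom_const C R b.
Proof. by apply: lrmorph_ext => s; rewrite /= rmorph_alg. Qed.

End HomNaturality.

Section BhomComp.
Variables (D : comNzRingType) (S : comAlgType D) (B : biring S).
Variables (R R' : comAlgType D) (h : {lrmorphism R -> R'}).

Definition bhom_comp (phi : bhom B R) : bhom B R' :=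
  h \o (phi : {lrmorphism S -> R}).

(** Scaling by b is multiplication by [hom_const B R b], so naturality of sums, products and
    constants is enough. *)
Lemma bhom_comp_linear : linear bhom_comp.
Proof.
move=> b phi psi; rewrite /bhom_comp.
transitivity (h \o hom_add B (hom_mul B (hom_const B R b) phi) psi : bhom B R') => //.
by rewrite -hom_add_comp -hom_mul_comp -hom_const_comp.
Qed.

Lemma bhom_comp_monoid : monoid_morphism bhom_comp.
Proof.
split=> [|phi psi]; last by rewrite /bhom_comp bhom_mulE -hom_mul_comp.
exact: (esym (hom_const_comp B h 1)).
Qed.

End BhomComp.

(** * Homomorphisms on Int(D) and the image of X *)

Section TorsionFree.
Variables (D : idomainType) (R : comAlgType D).
Hypothesis R_tf : forall (d : D) (x : R), d != 0 -> d *: x = 0 -> x = 0.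

(** Some nonzero d carries f into D[X], where the two maps agree; torsion-freeness cancels d. *)
Lemma int_hom_ext (phi psi : {lrmorphism Int D -> R}) :
  phi (int_of_poly 'X) = psi (int_of_poly 'X) -> phi = psi.
Proof.
move=> eX; apply: lrmorph_ext => f.
have e : (phi \o @int_of_poly D : {lrmorphism {poly D} -> R}) =
         (psi \o @int_of_poly D : {lrmorphism {poly D} -> R}) by apply: poly_hom_ext.
have [d [g [d0 dfg]]] := frac_poly_denom (int_poly f).
have df : d *: f = int_of_poly g by apply: val_inj.
apply/eqP; rewrite -subr_eq0; apply/eqP/(R_tf d0).
rewrite scalerBr -!linearZ /= df.
by have /= -> := congr1 (fun k : {lrmorphism {poly D} -> R} => k g) e; rewrite subrr.
Qed.

End TorsionFree.

Section IntOperations.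
Variables (D : idomainType) (B : biring (Int D)).
Hypothesis B_ext : biring_hom (poly_biring D) B (@int_of_poly D).
Variable R : comAlgType D.
Implicit Types phi psi : {lrmorphism Int D -> R}.

Lemma int_hom_addX phi psi :
  hom_add B phi psi (int_of_poly 'X) = phi (int_of_poly 'X) + psi (int_of_poly 'X).
Proof.
have [addE _ _] := B_ext; rewrite /= addE /= poly_evX linearD /= !tens_mapE /=.
by rewrite linearD /= !tens_pairE !rmorph1 mulr1 mul1r.
Qed.

Lemma int_hom_mulX phi psi :
  hom_mul B phi psi (int_of_poly 'X) = phi (int_of_poly 'X) * psi (int_of_poly 'X).
Proof.
have [_ mulE _] := B_ext; rewrite /= mulE /= poly_evX tens_mapE /=.
by rewrite tens_pairE.
Qed.

Lemma int_hom_constX b : hom_const B R b (int_of_poly 'X) = b%:A.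
Proof. by have [_ _ cE] := B_ext; rewrite /= cE /= poly_evX. Qed.

End IntOperations.

(** * Evaluation at points of D *)

Section IntVal.
Variables (D : idomainType) (a : D).

Let tofrac_inj (x y : D) : x%:F = y%:F -> x = y.
Proof. by move/eqP; rewrite tofrac_eq => /eqP. Qed.

Definition int_at (f : Int D) : D := int_val f a.

Lemma int_at_additive : zmod_morphism int_at.
Proof.
move=> f g; apply: tofrac_inj; rewrite tofracB !int_valE.
by rewrite hornerD hornerN.
Qed.

Lemma int_at_monoid : monoid_morphism int_at.
Proof.
by split=> [|f g]; apply: tofrac_inj; rewrite ?tofracM !int_valE ?hornerM ?hornerC.
Qed.

Lemma int_at_scalable : scalable_for *%R int_at.
Proof. by move=> b f; apply: tofrac_inj; rewrite tofracM !int_valE hornerZ. Qed.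

HB.instance Definition _ :=
  GRing.isZmodMorphism.Build (Int D) D int_at int_at_additive.
HB.instance Definition _ :=
  GRing.isMonoidMorphism.Build (Int D) D int_at int_at_monoid.
HB.instance Definition _ :=
  GRing.isScalable.Build D (Int D) D *%R int_at int_at_scalable.

Lemma int_atE f : (int_at f)%:F = (int_poly f).[a%:F].
Proof. exact: int_valE. Qed.

Lemma int_at_poly p : int_at (int_of_poly p) = p.[a].
Proof. by apply: tofrac_inj; rewrite int_valE horner_map. Qed.

Lemma int_at_alg b : int_at b%:A = b.
Proof. by apply: tofrac_inj; rewrite int_valE /= hornerZ hornerC mulr1. Qed.

End IntVal.

(** * Evaluation at points of the completion *)

Section Completion.
Variables (D : idomainType) (D_ded : dedekind D) (m : idealr D).
Hypothesis m_max : maximal_ideal m.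
Local Notation Dm := (completion m).
Local Notation quo n := {ideal_quot (ideal_pow m n)}.
Local Notation ev := (int_eval D_ded m_max).

Lemma completion_tf (d : D) (x : Dm) : d != 0 -> d *: x = 0 -> x = 0.
Proof.
move=> d0 /(completion_domain D_ded m_max)/orP[|/eqP//].
rewrite -(rmorph0 (@to_completion D m)) (inj_eq (to_completion_inj D_ded m_max)).
by rewrite (negPf d0).
Qed.

Lemma int_evalX alpha : ev alpha (int_of_poly 'X) = alpha.
Proof.
suff : (ev alpha (int_of_poly 'X) : completion_idomain D_ded m_max)%:F =
       (alpha : completion_idomain D_ded m_max)%:F.
  by move/eqP; rewrite tofrac_eq => /eqP.
by rewrite int_evalE /frac_eval /= !map_polyX hornerX.
Qed.

(** Continuity, uniform in alpha: write d f = g with g in D[X] and choose k with d outside m^k. Then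
    g(alpha) and g(a) agree modulo m^(k+1), and cancelling d leaves a congruence modulo m. *)
Lemma reduction_at_approx (f : Int D) : exists k, forall n (alpha : Dm) a, (k <= n)%N ->
  alpha n = \pi_(quo n) a -> reduction_at D_ded m_max alpha f = \pi_{ideal_quot m} (int_at a f).
Proof.
have [d [g [d0 dfg]]] := frac_poly_denom (int_poly f).
have df : d *: f = int_of_poly g by apply: val_inj.
have [k dk] := inpow_sep D_ded m_max d0.
exists k => n alpha a /subnKC <- /compon_rep alphaE; rewrite /reduction_at /=.
pose r := repr (ev alpha f k).
have -> : cred (ev alpha f) = \pi_{ideal_quot m} r.
  by apply: (@compon_rep _ _ _ 0 k); rewrite reprK.
have gE : d *: ev alpha f = (map_poly (@to_completion D m) g).[alpha].
  have e : (poly_ev alpha : {lrmorphism {poly D} -> Dm}) =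
           (ev alpha \o @int_of_poly D : {lrmorphism {poly D} -> Dm}).
    by apply: poly_hom_ext; apply: etrans (poly_evX alpha) (esym (int_evalX alpha)).
  have /= := congr1 (fun h : {lrmorphism {poly D} -> Dm} => h g) e.
  rewrite -df linearZ /= => <-.
  rewrite /poly_ev /horner_alg /horner_morph; congr _.[_]; apply: eq_map_poly => x.
  exact: (mulr1 (to_completion m x : Dm)).
apply/quo_eq; apply: (inpowM_prime D_ded m_max dk (q := 1)); rewrite addn1.
rewrite mulrBr; apply/inpow_pi; rewrite rmorphM /= reprK.
transitivity (cproj k (d *: ev alpha f)) => //; rewrite gE -horner_map -map_poly_comp.
have -> : d * int_at a f = g.[a].
  by rewrite -int_at_poly -df linearZ.
by rewrite -[RHS]horner_map; congr _.[_].
Qed.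

Section Algebra.
Variable B : biring (Int D).
Hypothesis B_ext : biring_hom (poly_biring D) B (@int_of_poly D).

(** Evaluation before reduction: unlike D/m, the completion is torsion-free, so [int_hom_ext]
    applies. *)
Definition to_completion_hom (alpha : Dm) : bhom B Dm := ev alpha.

Lemma to_completion_hom_linear : linear to_completion_hom.
Proof.
move=> a alpha beta; apply: (int_hom_ext completion_tf); apply: (etrans (int_evalX _)).
apply/esym/(etrans (int_hom_addX B_ext _ _)).
congr (_ + _); last exact: int_evalX.
apply: (etrans (int_hom_mulX B_ext _ _)); rewrite int_hom_constX //.
by rewrite -scalerAl mul1r; congr (_ *: _); apply: int_evalX.
Qed.

Lemma to_completion_hom_monoid : monoid_morphism to_completion_hom.
Proof.
split=> [|alpha beta]; apply: (int_hom_ext completion_tf);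
  apply: (etrans (int_evalX _)); apply/esym.
  by apply: etrans (scale1r _); apply: (int_hom_constX B_ext).
by apply: (etrans (int_hom_mulX B_ext _ _)); congr (_ * _); apply: int_evalX.
Qed.

Lemma to_residue_hom_linear : linear (to_residue_hom D_ded m_max B).
Proof.
move=> a alpha beta; rewrite -[LHS]/(bhom_comp (@cred D m) (to_completion_hom _)).
by rewrite to_completion_hom_linear bhom_comp_linear.
Qed.

Lemma to_residue_hom_monoid : monoid_morphism (to_residue_hom D_ded m_max B).
Proof.
have [c1 cM] := bhom_comp_monoid B (@cred D m).
have [e1 eM] := to_completion_hom_monoid.
split=> [|alpha beta]; rewrite -[LHS]/(bhom_comp (@cred D m) (to_completion_hom _)).
  by rewrite e1.
by rewrite eM cM.
Qed.

End Algebra.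
End Completion.

(** * Separating polynomials and bijectivity *)

Section Core.
Variables (D : idomainType) (D_ded : dedekind D) (m : idealr D).
Hypothesis m_max : maximal_ideal m.
Variable s : seq {ideal_quot m}.
Hypotheses (s_uniq : uniq s) (s_full : forall x, x \in s).
Local Notation pi := (\pi_{ideal_quot m}).

Lemma pi0 a : pi a = 0 <-> a \in m.
Proof. by rewrite -(rmorph0 pi) quo_eq subr0. Qed.

Lemma prod_notin (I : Type) (r : seq I) (P : pred I) (F : I -> D) :
  (forall i, P i -> F i \notin m) -> \prod_(i <- r | P i) F i \notin m.
Proof.
move=> FP; apply: (big_ind (fun x => x \notin m)) => //; first by rewrite idealr1.
by move=> x y; apply: maximal_prime.
Qed.

Lemma prod_in (I : eqType) (r : seq I) (P : pred I) (F : I -> D) i :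
  i \in r -> P i -> F i \in m -> \prod_(i <- r | P i) F i \in m.
Proof. by move=> ir Pi Fi; rewrite (big_rem i) //= Pi mulrC idealMr. Qed.

Definition residue_prod (f : Int D) : Int D := \prod_(r <- s) (f - (repr r)%:A).

Lemma int_at_residue_prod f a :
  int_at a (residue_prod f) = \prod_(r <- s) (int_at a f - repr r).
Proof.
rewrite rmorph_prod; apply: eq_bigr => r _.
by rewrite rmorphB /= int_at_alg.
Qed.

Lemma sub_repr_in a (r : {ideal_quot m}) : (a - repr r \in m) = (pi a == r).
Proof. by rewrite -{2}[r]reprK; apply/idP/eqP => /quo_eq. Qed.

Lemma residue_prod_in f a : int_at a (residue_prod f) \in m.
Proof.
rewrite int_at_residue_prod; apply: (prod_in (s_full (pi (int_at a f)))) => //.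
by rewrite sub_repr_in.
Qed.

Section Uniformizer.
Variables u t : D.
Hypotheses (um : u \notin m) (tm : t \in m) (t0 : t != 0).
Hypothesis ut : forall x, x \in m -> exists c, u * x = t * c.

Lemma int_div (g : Int D) :
  (forall a, int_at a g \in m) -> exists h : Int D, t *: h = u *: g.
Proof.
move=> gm; have tF : t%:F != 0 :> {fraction D} by rewrite tofrac_eq0.
have hP : t%:F^-1 *: (u%:F *: int_poly g) \in @int_valued D.
  apply/int_valuedP => a; have [c cE] := ut (gm a); exists c; apply: (mulfI tF).
  by rewrite !hornerZ (mulVKf tF) -int_atE -!tofracM cE.
by exists (MkInt hP); apply: val_inj; rewrite /= scalerA mulfV // scale1r.
Qed.

Lemma residue_step : exists F : nat -> Int D, F 0%N = int_of_poly 'X /\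
  forall k, t *: F k.+1 = u *: residue_prod (F k).
Proof.
have [nxt nxtP] := choice (fun f => int_div (residue_prod_in f)).
by exists (fun k => iter k nxt (int_of_poly 'X)); split=> // k; apply: nxtP.
Qed.

(* The cofactor c is a unit modulo m because the residues r are pairwise      *)
(* distinct: it reduces to the derivative of \prod_r (X - r) at a simple root. *)
Lemma residue_prod_sub y y' : pi y = pi y' -> exists2 c, c \notin m &
  \prod_(r <- s) (y - repr r) - \prod_(r <- s) (y' - repr r) = (y - y') * c.
Proof.
move=> yy'; rewrite !(bigD1_seq (pi y)) //=.
pose A := \prod_(r <- s | r != pi y) ('X - (repr r)%:P) : {poly D}.
have AE z : \prod_(r <- s | r != pi y) (z - repr r) = A.[z].
  by rewrite horner_prod; apply: eq_bigr => r _; rewrite !hornerE.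
have [q qE] : exists q, A.[y] - A.[y'] = q * (y - y').
  have /factor_theorem[p pE] : root (A - A.[y']%:P) y' by rewrite rootE !hornerE subrr.
  by exists p.[y]; have := congr1 (horner^~ y) pE; rewrite !hornerE.
exists (A.[y] + (y' - repr (pi y)) * q).
  have y'm : (y' - repr (pi y)) * q \in m by rewrite mulrC idealMr // sub_repr_in yy'.
  rewrite rpredDr // -AE; apply: prod_notin => r.
  by rewrite sub_repr_in eq_sym.
rewrite !AE.
have -> : (y - repr (pi y)) * A.[y] - (y' - repr (pi y)) * A.[y'] =
  (y - y') * A.[y] + (y' - repr (pi y)) * (A.[y] - A.[y']) by ring.
by rewrite qE; ring.
Qed.

End Uniformizer.

(** By [residue_prod_sub], t (F_(k+1)(a) - F_(k+1)(b)) is F_k(a) - F_k(b) times u c, with u c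
    outside m. Each step down in k thus gains one power of m. *)
Lemma separating_seq : exists F : nat -> Int D, forall n a b,
  (forall j, (j <= n)%N -> pi (int_at a (F j)) = pi (int_at b (F j))) ->
  a - b \in ideal_pow m n.
Proof.
have [u [t [um tm t0 ut]]] := uniformizer_ex D_ded m_max.
have [F [F0 FS]] := residue_step t0 ut; exists F => n a b ab.
(* The starting index k is generalised because the induction on n passes from F_k to F_(k+1). *)
suff : forall n k, (forall j, (j <= n)%N ->
    pi (int_at a (F (k + j)%N)) = pi (int_at b (F (k + j)%N))) ->
    inpow m n.+1 (int_at a (F k) - int_at b (F k)).
  by move=> /(_ n 0%N ab); rewrite F0 !int_at_poly !hornerX.
elim=> [|i IHi] k abk; first by apply/quo_eq; have := abk 0%N; rewrite addn0; apply.
have IH : inpow m i.+1 (int_at a (F k.+1) - int_at b (F k.+1)).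
  by apply: IHi => j jn; have := abk j.+1 jn; rewrite addnS.
have tE x : t * int_at x (F k.+1) = u * \prod_(r <- s) (int_at x (F k) - repr r).
  by rewrite -int_at_residue_prod; have := congr1 (@int_at D x) (FS k); rewrite !linearZ.
have [|c cm cE] := @residue_prod_sub (int_at a (F k)) (int_at b (F k)).
  by have := abk 0%N isT; rewrite addn0.
apply: (inpow_cancel m_max (maximal_prime m_max um cm)).
have -> : u * c * (int_at a (F k) - int_at b (F k)) =
    t * (int_at a (F k.+1) - int_at b (F k.+1)).
  by rewrite [RHS]mulrBr !tE -mulrBr cE; ring.
exact: inpowM1.
Qed.

(** * Homomorphisms into a domain killed by m *)

Section Points.
Variables (A : comAlgType D) (A_dom : GRing.integral_domain_axiom A).
Hypothesis mA0 : forall (a : D) (x : A), a \in m -> a *: x = 0.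
Variable phi : {lrmorphism Int D -> A}.

Lemma alg_eq0 (a : D) : a%:A = 0 :> A -> a \in m.
Proof.
move=> a0; apply: contrapT => /negP am; have [v [w [wm e]]] := maximal_comax m_max am.
have /eqP := oner_neq0 A; apply.
by rewrite -[1]scale1r e scalerDl (mA0 _ wm) addr0 mulrC -scalerA a0 scaler0.
Qed.

Lemma hom_in_eq0 (g : Int D) : (forall a, int_at a g \in m) -> phi g = 0.
Proof.
move=> gm; have [u [t [um tm t0 ut]]] := uniformizer_ex D_ded m_max.
have [h hE] := int_div t0 ut gm.
have : u%:A * phi g = 0 by rewrite -scalerAl mul1r -linearZ /= -hE linearZ /= mA0.
by move=> /A_dom/orP[/eqP/alg_eq0|/eqP//]; rewrite (negPf um).
Qed.

Lemma hom_alg (a : D) : phi a%:A = a%:A.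
Proof. by rewrite linearZ /= rmorph1. Qed.

(** The product of the phi(f) - r over all residues r vanishes in a domain, so some factor is
    zero. *)
Lemma hom_residue (f : Int D) : exists a : D, phi f = a%:A.
Proof.
have : phi (residue_prod f) = 0 by apply/hom_in_eq0/residue_prod_in.
rewrite /residue_prod rmorph_prod; elim: s => [|r s' IHs].
  by rewrite big_nil => /eqP; rewrite oner_eq0.
rewrite big_cons => /A_dom/orP[|/eqP//]; rewrite rmorphB /= hom_alg subr_eq0 => /eqP ->.
by exists (repr r).
Qed.

Lemma hom_approx (fs : seq (Int D)) :
  exists x, forall f, f \in fs -> phi f = (int_at x f)%:A.
Proof.
have [c cE] := choice hom_residue; apply: contrapT => no.
(* G(x) lies outside m exactly when x is a point as sought, while phi sends G to the image of C,
   which is outside m. *)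
pose G := \prod_(f <- fs) \prod_(r <- s | r != pi (c f)) (f - (repr r)%:A).
pose C := \prod_(f <- fs) \prod_(r <- s | r != pi (c f)) (c f - repr r).
have phiG : phi G = C%:A.
  rewrite -[C%:A]/(in_alg A C) !rmorph_prod; apply: eq_bigr => f _.
  rewrite !rmorph_prod; apply: eq_bigr => r _.
  by rewrite !rmorphB /= hom_alg cE.
suff : C \in m.
  apply/negP; apply: prod_notin => f _; apply: prod_notin => r.
  by rewrite sub_repr_in eq_sym.
apply: alg_eq0; rewrite -phiG; apply: hom_in_eq0 => x.
have [f ff fx] : exists2 f, f \in fs & pi (int_at x f) != pi (c f).
  apply: contrapT => nof; apply: no; exists x => f ff; rewrite cE.
  apply/eqP; rewrite -subr_eq0 -scalerBl; apply/eqP/mA0/quo_eq.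
  by apply: contrapT => /eqP ne; apply: nof; exists f => //; rewrite eq_sym.
rewrite rmorph_prod; apply: (prod_in ff) => //; rewrite rmorph_prod.
apply: (prod_in (s_full (pi (int_at x f)))) => //.
by rewrite rmorphB /= int_at_alg sub_repr_in.
Qed.

Lemma alg_eq_pi (a b : D) : a%:A = b%:A :> A -> pi a = pi b.
Proof. by move=> ab; apply/quo_eq/alg_eq0; rewrite scalerBl ab subrr. Qed.

Lemma hom_point : exists alpha : completion m, forall f,
  phi f = residue_lift mA0 (reduction_at D_ded m_max alpha f).
Proof.
have [F Fsep] := separating_seq.
have [x xP] := choice (fun n => hom_approx (mkseq F n.+1)).
have xE n j : (j <= n)%N -> phi (F j) = (int_at (x n) (F j))%:A.
  by move=> jn; apply: xP; apply/mapP; exists j; rewrite // mem_iota.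
have compat n a : \pi_{ideal_quot (ideal_pow m n.+1)} (x n.+1) =
    \pi_{ideal_quot (ideal_pow m n.+1)} a ->
    \pi_{ideal_quot (ideal_pow m n)} (x n) = \pi_{ideal_quot (ideal_pow m n)} a.
  (* Both x_n and x_(n+1) realise phi on F_0, ..., F_n, hence agree modulo m^(n+1). *)
  move=> /compon_sub <-; apply/quo_eq/Fsep => j jn; apply: alg_eq_pi.
  by rewrite -!xE // ltnW.
pose alpha : completion m :=
  Completion (compon := fun n => \pi_{ideal_quot (ideal_pow m n)} (x n)) compat.
exists alpha => f; have [k kP] := reduction_at_approx D_ded m_max f.
(* The auxiliary point y realises phi on f as well as on F_0, ..., F_k; the latter make y represent
   alpha modulo m^(k+1), so continuity computes f(alpha) from f(y). *)
have [y yP] := hom_approx (f :: mkseq F k.+1).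
rewrite (kP k alpha y) //; first by rewrite residue_lift_pi; apply: yP; rewrite mem_head.
apply/quo_eq/Fsep => j jk; apply: alg_eq_pi; rewrite -xE //; apply: yP.
by rewrite inE; apply/orP; right; apply/mapP; exists j; rewrite // mem_iota.
Qed.

Lemma residue_lift_inj : injective (residue_lift mA0).
Proof.
move=> a b; rewrite -[a]reprK -[b]reprK !residue_lift_pi; exact: alg_eq_pi.
Qed.

End Points.

Lemma reduction_at_inj : injective (reduction_at D_ded m_max).
Proof.
move=> alpha beta ab; have [F Fsep] := separating_seq; apply: completionP => n.
have [k kP] := choice (fun j => reduction_at_approx D_ded m_max (F j)).
(* At level K, representatives of alpha and beta give the reduced values of F_0, ..., F_n and still
   determine the components at n. *)
pose K := (n + \max_(j < n.+1) k j)%N.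
have KE (gamma : completion m) := esym (reprK (gamma K)).
rewrite (@compon_rep _ _ alpha n _ _ (KE alpha)) (@compon_rep _ _ beta n _ _ (KE beta)).
apply/quo_eq/Fsep => j jn.
have jK : (k j <= K)%N by rewrite (leq_trans _ (leq_addl _ _)) // (leq_bigmax (Ordinal (jn : (j < n.+1)%N))).
by rewrite -(kP j K alpha) ?reprK // -(kP j K beta) ?reprK // ab.
Qed.

End Core.

Lemma bij_of_inj_surj (T U : Type) (f : T -> U) :
  injective f -> (forall y, exists x, y = f x) -> bijective f.
Proof.
move=> f_inj f_surj; have [g gE] := choice f_surj.
by exists g => [x|y]; [apply: f_inj|]; rewrite -gE.
Qed.

Theorem proposition6 (D : idomainType) (D_ded : dedekind D)
    (m : idealr D) (m_max : maximal_ideal m)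
    (m_fin : finite_set [set: {ideal_quot m}])
    (B : biring (Int D))
    (B_ext : biring_hom (poly_biring D) B (@int_of_poly D)) :
  dalg_iso (to_residue_hom D_ded m_max B) /\
  forall (A : comAlgType D) (A_dom : GRing.integral_domain_axiom A)
      (mA0 : forall (a : D) (x : A), a \in m -> a *: x = 0),
    [/\ dalg_iso (to_residue_hom D_ded m_max B),
        dalg_iso (hom_extend mA0 : bhom B {ideal_quot m} -> bhom B A),
        dalg_iso (to_hom D_ded m_max B mA0)
      & to_hom D_ded m_max B mA0 =1 hom_extend mA0 \o to_residue_hom D_ded m_max B].
Proof.
have /finite_seqP[s0 s0E] := m_fin.
pose s := undup s0; have s_uniq : uniq s by apply: undup_uniq.
have s_full x : x \in s.
  by rewrite mem_undup; have : [set: {ideal_quot m}] x by []; rewrite s0E.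
have quoZ (a : D) (x : {ideal_quot m}) : a \in m -> a *: x = 0.
  move=> am; rewrite -[x]reprK -[LHS](rmorphM \pi_{ideal_quot m}).
  by apply/pi0; rewrite mulrC idealMr.
have quo_dom : GRing.integral_domain_axiom {ideal_quot m}.
  move=> x y; rewrite -[x]reprK -[y]reprK -rmorphM => /pi0 xy.
  have [/pi0 ->|xm] := boolP (repr x \in m); first by rewrite eqxx.
  have [/pi0 ->|ym] := boolP (repr y \in m); first by rewrite eqxx orbT.
  by case/negP: (maximal_prime m_max xm ym).
(* D/m is itself a domain killed by m; with this identity [hom_point] for A = D/m gives
   surjectivity. *)
have lift_id x : residue_lift quoZ x = x.
  rewrite -[x]reprK residue_lift_pi -[1](rmorph1 \pi_{ideal_quot m}).
  by rewrite -[LHS](rmorphM \pi_{ideal_quot m}) mulr1.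
have red_inj : injective (to_residue_hom D_ded m_max B).
  move=> alpha beta ab.
  exact: (reduction_at_inj s_uniq s_full ab).
have iso1 : dalg_iso (to_residue_hom D_ded m_max B).
  split; last exact: to_residue_hom_monoid; last exact: to_residue_hom_linear.
  apply: bij_of_inj_surj => // phi.
  have [alpha alphaE] := hom_point D_ded m_max s_uniq s_full quo_dom quoZ phi.
  by exists alpha; apply: lrmorph_ext => f; rewrite alphaE lift_id.
split=> // A A_dom mA0.
have ext_lin : linear (hom_extend mA0 : bhom B {ideal_quot m} -> bhom B A).
  exact: bhom_comp_linear.
have ext_mon : monoid_morphism (hom_extend mA0 : bhom B {ideal_quot m} -> bhom B A).
  exact: bhom_comp_monoid.
have ext_bij : bijective (hom_extend mA0 : bhom B {ideal_quot m} -> bhom B A).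
  apply: bij_of_inj_surj => [phi psi e|phi].
    apply: lrmorph_ext => f; apply: (residue_lift_inj m_max (mA0 := mA0)).
    exact: (congr1 (fun h : {lrmorphism Int D -> A} => h f) e).
  (* Every homomorphism into A comes from a point of the completion, hence factors through D/m. *)
  have [alpha alphaE] := hom_point D_ded m_max s_uniq s_full A_dom mA0 phi.
  by exists (to_residue_hom D_ded m_max B alpha); apply: lrmorph_ext => f.
have [red_bij red_lin red_mon] := iso1.
split=> //; split; first exact: (bij_comp ext_bij red_bij).
- move=> a x y.
  by rewrite -[LHS]/(hom_extend mA0 (to_residue_hom D_ded m_max B _)) red_lin ext_lin.
split=> [|x y].
  by rewrite -[LHS]/(hom_extend mA0 (to_residue_hom D_ded m_max B _)) red_mon.1 ext_mon.1.
by rewrite -[LHS]/(hom_extend mA0 (to_residue_hom D_ded m_max B _)) red_mon.2 ext_mon.2.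
Qed.
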